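(* Let $\mu\colon Z^1(M)\to B^1(M)$ be a homomorphism, let $c\neq0$ (so $c>0$), and write $\Delta=\Delta_{(\mu,c)}$. For any $\psi\in\mathrm{Symp}_0(M,\omega)$ and any radius $r$, $C_\psi(S_\Delta(r))=S_\Delta(r)$, where $C_\psi\colon\mathrm{Symp}_0(M,\omega)\to\mathrm{Symp}_0(M,\omega)$ is the conjugation $C_\psi(\varphi)=\psi\varphi\psi^{-1}$ and $S_\Delta(r)=\{\theta\in\mathrm{Symp}_0(M,\omega)\,|\,\Delta(\theta)=r\}$.
   Context: $(M,\omega)$ is a closed symplectic manifold; $Z^1(M)$ and $B^1(M)$ are the real vector spaces of closed and exact smooth $1$-forms on $M$. Fix a norm $n^B$ on $B^1(M)$ and a Riemannian metric $g$ on $M$; $\|\cdot\|_{L^2}$ is the $L^2$-norm on $1$-forms induced by $g$. For a homomorphism (linear map) $\mu\colon Z^1(M)\to B^1(M)$ and a real number $c\geq0$, set $n_{(\mu,c)}(\alpha)=n^B(\mu(\alpha))+c\|\alpha-\mu(\alpha)\|_{L^2}$ for $\alpha\in Z^1(M)$. $\mathrm{Symp}_0(M,\omega)$ is the identity component of the group of symplectomorphisms. A (smooth) path $\Psi=\{\psi_t\}_{t\in[0,1]}$ of symplectomorphisms with $\psi_0=\mathrm{id}$ corresponds to the path $\alpha(\Psi)=\{\alpha(\Psi)_t\}_{t\in[0,1]}$ in $Z^1(M)$ given by $\alpha(\Psi)_t=\omega(X_t^\Psi,\cdot)$, where $\partial_t\psi_t=X_t^\Psi(\psi_t)$. $\mathrm{Ham}(M,\omega)$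 is the group of Hamiltonian diffeomorphisms: the endpoints $\psi_1$ of such paths with $\alpha(\Psi)_t\in B^1(M)$ for all $t$. The length of $\Psi$ is $\ell_{(\mu,c)}(\Psi)=\int_0^1 n_{(\mu,c)}(\alpha(\Psi)_t)\,dt$. For $\phi,\psi\in\mathrm{Symp}_0(M,\omega)$, $d_{(\mu,c)}(\mathrm{id},\phi)$ is the infimum of $\ell_{(\mu,c)}(\Phi)$ over all paths $\Phi$ of symplectomorphisms from $\mathrm{id}$ to $\phi$, $d_{(\mu,c)}(\phi,\psi)=d_{(\mu,c)}(\mathrm{id},\phi^{-1}\psi)$, and $\Delta_{(\mu,c)}(\psi)=\inf\{d_{(\mu,c)}(\varphi,\psi)\,|\,\varphi\in\mathrm{Ham}(M,\omega)\}$. *)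

(* Defs.v *)
From HB Require Import structures.
From mathcomp Require Import all_boot all_order all_algebra.
From mathcomp Require Import all_classical all_reals all_analysis.

Set Implicit Arguments.
Unset Strict Implicit.
Unset Printing Implicit Defensive.

Import Order.TTheory GRing.Theory Num.Theory.
Import numFieldNormedType.Exports.

Local Open Scope classical_set_scope.
Local Open Scope ring_scope.

Section EuclideanSmoothness.
Context {R : realType} {k : nat} {W : normedModType R}.
Implicit Types (f : 'rV[R]_k -> W) (A U : set 'rV[R]_k).

Definition iter_derive (s : seq 'rV[R]_k) f : 'rV[R]_k -> W :=
  foldr (fun v g x => 'D_v g x) f s.

Definition smooth_open U f : Prop :=
  forall s x, U x -> differentiable (iter_derive s f) x.

(* Smoothness on an arbitrary subset: locally the restriction of a smooth
   function on an open set.  The boundary times 0 and 1 of a path need it. *)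
Definition smooth_on A f : Prop :=
  forall x, A x -> exists U g,
    [/\ open U, U x, smooth_open U g & forall y, A y -> U y -> f y = g y].

End EuclideanSmoothness.

(* The preferred chart [chart p] at each point p gives the tangent space at p
   the model 'rV_m; the charts [chart p] together form a smooth atlas.
   [chart_inv p] is meaningful only on [chart p @` dom p]. *)
Record closed_manifold (R : realType) (m : nat) := ClosedManifold {
  carrier :> ptopologicalType;
  dom : carrier -> set carrier;
  chart : carrier -> carrier -> 'rV[R]_m;
  chart_inv : carrier -> 'rV[R]_m -> carrier;
  manifold_hausdorff : hausdorff_space carrier;
  manifold_compact : compact [set: carrier];
  dom_open : forall p, open (dom p);
  mem_dom : forall p, dom p p;
  img_open : forall p, open (chart p @` dom p);
  chartK : forall p x, dom p x -> chart_inv p (chart p x) = x;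
  chart_continuous : forall p, {within dom p, continuous (chart p)};
  chart_inv_continuous : forall p,
    {within chart p @` dom p, continuous (chart_inv p)};
  transition_smooth : forall p q,
    smooth_on (chart p @` (dom p `&` dom q)) (chart q \o chart_inv p)
}.

Arguments dom {R m c}.
Arguments chart {R m c}.
Arguments chart_inv {R m c}.

Section Manifold.
Context {R : realType} {m : nat} (M : closed_manifold R m).

Definition img (p : M) : set 'rV[R]_m := chart p @` dom p.

(* Tangent vectors are rows and covectors columns, both in the coordinates of
   the preferred chart of their base point; a covector a takes the value
   v *m a on v, and a bilinear form b the value v *m b *m w^T on (v, w). *)
Definition form1 : Type := M -> 'cV[R]_m.
Definition form2 : Type := M -> 'M[R]_m.

(* Row-vector convention: v in chart p becomes v *m to_preferred p y in the
   preferred chart of the point with p-coordinates y. *)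
Definition to_preferred (p : M) (y : 'rV[R]_m) : 'M[R]_m :=
  'J (chart (chart_inv p y) \o chart_inv p) y.

Definition local1 (a : form1) (p : M) (y : 'rV[R]_m) : 'cV[R]_m :=
  to_preferred p y *m a (chart_inv p y).

Definition local2 (b : form2) (p : M) (y : 'rV[R]_m) : 'M[R]_m :=
  to_preferred p y *m b (chart_inv p y) *m (to_preferred p y)^T.

Definition smooth_fun (f : M -> R) : Prop :=
  forall p, smooth_on (img p) (f \o chart_inv p).
Definition smooth_form1 (a : form1) : Prop :=
  forall p, smooth_on (img p) (local1 a p).
Definition smooth_form2 (b : form2) : Prop :=
  forall p, smooth_on (img p) (local2 b p).

Definition ebase (i : 'I_m) : 'rV[R]_m := delta_mx 0 i.

Definition Z1 : set form1 := [set a | smooth_form1 a /\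
  forall p y, img p y -> forall i j,
    ('D_(ebase i) (local1 a p) y) j 0 = ('D_(ebase j) (local1 a p) y) i 0].

Definition dfun (f : M -> R) : form1 :=
  fun x => \col_i 'D_(ebase i) (f \o chart_inv x) (chart x x).

Definition B1 : set form1 := [set dfun f | f in smooth_fun].

Definition symplectic_form (w : form2) : Prop :=
  [/\ smooth_form2 w,
      forall x, (w x)^T = - w x,
      forall x, w x \in unitmx &
      forall p y, img p y -> forall i j k,
        ('D_(ebase i) (local2 w p) y) j k + ('D_(ebase j) (local2 w p) y) k i
        + ('D_(ebase k) (local2 w p) y) i j = 0].

Definition riemannian_metric (g : form2) : Prop :=
  [/\ smooth_form2 g,
      forall x, (g x)^T = g x &
      forall x (v : 'rV[R]_m), v != 0 -> 0 < (v *m g x *m v^T) 0 0].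

Definition borel : Type := g_sigma_algebraType (@open M).
HB.instance Definition _ := Measurable.on borel.

End Manifold.

(* Lebesgue integral over R^m as an iterated integral (Tonelli). *)
Fixpoint lebesgue_int {R : realType} (m : nat) : ('rV[R]_m -> \bar R) -> \bar R :=
  match m return ('rV[R]_m -> \bar R) -> \bar R with
  | 0 => fun f => f 0
  | m'.+1 => fun f => (\int[lebesgue_measure]_(t in [set: R])
       lebesgue_int (fun y : 'rV[R]_m' => f (row_mx (t%:M : 'rV[R]_1) y)))%E
  end.

Section L2.
Context {R : realType} {m : nat} (M : closed_manifold R m).

(* This determines the Borel measure vol uniquely: it is sqrt(det g_ij) dy in
   every chart, and the chart domains cover M. *)
Definition riemannian_volume (g : form2 M)
    (vol : {measure set (borel M) -> \bar R}) : Prop :=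
  forall (p : M) (A : set (borel M)), measurable A -> A `<=` dom p ->
    vol A = lebesgue_int (fun y => (\1_(chart p @` A) y *
                            Num.sqrt (\det (local2 g p y)))%:E).

Definition L2norm (g : form2 M) (vol : {measure set (borel M) -> \bar R})
    (a : form1 M) : R :=
  Num.sqrt (Rintegral vol [set: borel M]
              (fun x => ((a x)^T *m invmx (g x) *m a x) 0 0)).

End L2.

Definition norm_on {R : realType} {V : lmodType R} (B : set V) (n : V -> R) :=
  [/\ forall a, B a -> 0 <= n a,
      forall a, B a -> n a = 0 -> a = 0,
      forall (k : R) a, B a -> n (k *: a) = `|k| * n a &
      forall a b, B a -> B b -> n (a + b) <= n a + n b].

(* A linear map Z -> B between linear subspaces of V, as a function on V whose
   values off Z are irrelevant. *)
Definition linear_between {R : realType} {V : lmodType R} (Z B : set V)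
    (mu : V -> V) : Prop :=
  (forall a, Z a -> B (mu a)) /\
  (forall (k : R) a b, Z a -> Z b -> mu (k *: a + b) = k *: mu a + mu b).

Record self_bij (T : Type) := SelfBij {
  fwd :> T -> T;
  bwd : T -> T;
  fwdK : cancel fwd bwd;
  bwdK : cancel bwd fwd
}.

Section SelfBijGroup.
Variable T : Type.
Implicit Types f g h : self_bij T.

Lemma self_bij_eq f g : (forall x, f x = g x) -> f = g.
Proof.
case: f g => [f f' fK f'K] [g g' gK g'K] /= fg.
have E : f = g by apply: funext.
subst g; have E : f' = g' by apply: funext => x; rewrite -{1}(g'K x) fK.
by subst g'; congr SelfBij; exact: Prop_irrelevance.
Qed.

Definition self_bij_one : self_bij T :=
  @SelfBij T id id (fun=> erefl) (fun=> erefl).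
Definition self_bij_inv f : self_bij T := SelfBij (@bwdK _ f) (@fwdK _ f).
Definition self_bij_mul f g : self_bij T :=
  SelfBij (can_comp (@fwdK _ f) (@fwdK _ g)) (can_comp (@bwdK _ g) (@bwdK _ f)).

HB.instance Definition _ := gen_eqMixin (self_bij T).
HB.instance Definition _ := gen_choiceMixin (self_bij T).

Fact self_bij_mulA : associative self_bij_mul.
Proof. by move=> f g h; exact: self_bij_eq. Qed.
Fact self_bij_mul1 : left_id self_bij_one self_bij_mul.
Proof. by move=> f; exact: self_bij_eq. Qed.
Fact self_bij_1mul : right_id self_bij_one self_bij_mul.
Proof. by move=> f; exact: self_bij_eq. Qed.
Fact self_bij_mulV : left_inverse self_bij_one self_bij_inv self_bij_mul.
Proof. by move=> f; apply: self_bij_eq => x /=; rewrite fwdK. Qed.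
Fact self_bij_Vmul : right_inverse self_bij_one self_bij_inv self_bij_mul.
Proof. by move=> f; apply: self_bij_eq => x /=; rewrite bwdK. Qed.

HB.instance Definition _ := isGroup.Build (self_bij T)
  self_bij_mulA self_bij_mul1 self_bij_1mul self_bij_mulV self_bij_Vmul.

End SelfBijGroup.

Section Symplectic.
Context {R : realType} {m : nat} {M : closed_manifold R m}.
Variable w : form2 M.

Definition smooth_map (F : M -> M) : Prop :=
  continuous F /\ forall p q : M,
    smooth_on [set y | img p y /\ dom q (F (chart_inv p y))]
              (chart q \o F \o chart_inv p).

Definition tangent_map (F : M -> M) (x : M) : 'M[R]_m :=
  'J (chart (F x) \o F \o chart_inv x) (chart x x).

Definition symplectomorphism (phi : self_bij M) : Prop :=
  [/\ smooth_map phi, smooth_map (phi^-1)%g &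
      forall x, tangent_map phi x *m w (phi x) *m (tangent_map phi x)^T = w x].

(* Smoothness of (t, x) |-> F t x on [0,1] x M; in charts (t, y) is the row
   vector row_mx t y. *)
Definition smooth_family (F : R -> M -> M) : Prop :=
  {within `[0, 1] `*` [set: M], continuous (fun z : R * M => F z.1 z.2)} /\
  forall p q : M,
    let t (z : 'rV[R]_(1 + m)) := lsubmx z 0 0 in
    let x (z : 'rV[R]_(1 + m)) := chart_inv p (rsubmx z) in
    smooth_on [set z | [/\ `[0, 1]%classic (t z), img p (rsubmx z) &
                           dom q (F (t z) (x z))]]
              (fun z => chart q (F (t z) (x z))).

(* Only the values at times in [0,1] are ever used. *)
Definition symp_path (Psi : R -> self_bij M) : Prop :=
  [/\ forall t, `[0, 1]%classic t -> symplectomorphism (Psi t),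
      smooth_family (fun t => Psi t),
      smooth_family (fun t => (Psi t)^-1)%g &
      Psi 0 = 1%g].

(* The derivative of s |-> Psi_s(x) at s = t (one-sided at t = 0, 1), in the
   preferred chart of Psi_t(x). *)
Definition velocity (Psi : R -> self_bij M) (t : R) (x : M) : 'rV[R]_m :=
  lim ((s - t)^-1 *: (chart (Psi t x) (Psi s x) - chart (Psi t x) (Psi t x))
       @[s --> within `[0, 1]%classic (t^')]).

Definition generator (Psi : R -> self_bij M) (t : R) (y : M) : 'rV[R]_m :=
  velocity Psi t ((Psi t)^-1%g y).

Definition path_form (Psi : R -> self_bij M) (t : R) : form1 M :=
  fun y => (generator Psi t y *m w y)^T.

(* The smooth-path component of the identity; the group of symplectomorphisms
   is locally smoothly path connected, so this is its identity component. *)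
Definition Symp0 : set (self_bij M) :=
  [set phi | exists2 Psi, symp_path Psi & Psi 1 = phi].

Definition Ham : set (self_bij M) :=
  [set phi | exists Psi, [/\ symp_path Psi,
     forall t, `[0, 1]%classic t -> B1 (path_form Psi t) & Psi 1 = phi]].

Section Metric.
Variables (nB : form1 M -> R) (g : form2 M).
Variables (vol : {measure set (borel M) -> \bar R}).
Variables (mu : form1 M -> form1 M) (c : R).

Definition nmuc (a : form1 M) : R :=
  nB (mu a) + c * L2norm g vol (a - mu a).

Definition path_length (Psi : R -> self_bij M) : \bar R :=
  (\int[lebesgue_measure]_(t in `[0%R, 1%R]) (nmuc (path_form Psi t))%:E)%E.

Definition dist_id (phi : self_bij M) : \bar R :=
  ereal_inf [set path_length Psi | Psi in
    [set Psi | symp_path Psi /\ Psi 1 = phi]].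

Definition dist (phi psi : self_bij M) : \bar R := dist_id (phi^-1 * psi)%g.

Definition Delta (psi : self_bij M) : \bar R :=
  ereal_inf [set dist phi psi | phi in Ham].

Definition Delta_sphere (r : R) : set (self_bij M) :=
  [set theta | Symp0 theta /\ Delta theta = r%:E].

End Metric.
End Symplectic.

Definition conjugation {T : Type} (psi phi : self_bij T) : self_bij T :=
  (psi * phi * psi^-1)%g.

(* Main.v *)
Require Import Defs.
From HB Require Import structures.
From mathcomp Require Import all_boot all_order all_algebra.
From mathcomp Require Import all_classical all_reals all_analysis.
From mathcomp Require Import ring lra.
Import Order.TTheory GRing.Theory Num.Theory.
Import numFieldNormedType.Exports.
Set Implicit Arguments.
Unset Strict Implicit.
Unset Printing Implicit Defensive.
Local Open Scope classical_set_scope.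
Local Open Scope ring_scope.

(** Write [psi * theta * psi^-1 = h * theta] with [h] the commutator of [psi] and
    [theta].  If [h] and [h^-1] preserve [Ham] under left multiplication, then
    the distances from Hamiltonian diffeomorphisms to [h * theta] and to [theta]
    are the same set of numbers, so [Delta] takes the same value at both, and
    conjugation by [psi] maps each sphere into itself; conjugation by [psi^-1]
    gives the reverse inclusion ([Delta_conj]).

    So commutators must act on [Ham] ([commutator_mul_Ham]).  Choose paths
    [Psi] and [Theta] ending at [psi] and [theta].  The class modulo exact forms
    of the 1-form of a path at a fixed time is its flux density, with values in
    an abelian group, and it is additive for pointwise products of paths
    ([flux_mul]).  Hence the path of commutators of [Psi] and [Theta] has exact
    1-forms at every time, and still does when multiplied by a Hamiltonian path.

    Additivity has three ingredients.  The velocity of a product path gives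
    [path_form (Psi * Phi) = path_form Psi + (Psi^-1)^* path_form Phi]
    ([path_form_mul]).  The form of a path is closed; this is used for
    [Phi^* path_form Phi], which has local primitives because the pull-back of
    the symplectic form by [Phi] to time and space is closed and its spatial
    part is constant in time ([pullback2_closed], [flux_form_locally_exact],
    [poincare]).  Finally a form with local primitives changes by an exact form
    under pull-back along an isotopy ([homotopy]): for a short time the increments
    of the local primitives along the isotopy fit together to one function on
    the compact manifold, and [0,1] is connected.

    Everything takes place in charts, where smoothness means that all iterated
    directional derivatives are differentiable.  At the ends of [0,1] the
    derivatives in time are one-sided; they are computed from smooth extensions
    of the chart expressions to open sets of time and space ([family_ext]). *)

(** * Differentials *)

Section Differential.
Context {R : realType}.

Lemma open_near (T : topologicalType) (U : set T) x : open U -> U x ->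
  \forall y \near x, U y.
Proof. by move=> oU Ux; exact: open_nbhs_nbhs (conj oU Ux). Qed.

Lemma eq_derive_open (V W : normedModType R) (f g : V -> W) U x v :
  open U -> U x -> (forall y, U y -> f y = g y) -> 'D_v f x = 'D_v g x.
Proof.
by move=> oU Ux fg; apply: near_eq_derive; exact: filterS (open_near oU Ux).
Qed.

(** This inequality and the next lemma trade the Landau form of
    differentiability for an epsilon estimate, in which near-equality and
    composition with curves are immediate. *)
Lemma differentiable_dist (V W : normedModType R) (f : V -> W) x :
  differentiable f x -> forall e, 0 < e ->
  \forall y \near x, `|f y - f x - 'd f x (y - x)| <= e * `|y - x|.
Proof.
move=> df e e0.
have /eqaddoP/(_ e e0) H := diff_locally df.
rewrite (near_shift 0 x); apply: filterS H => h /=.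
by rewrite !fctE /= subr0 addrK opprD addrA.
Qed.

Lemma dist_differentiable (V W : normedModType R) (f : V -> W)
    (L : {linear V -> W}) x : continuous L ->
  (forall e, 0 < e -> \forall y \near x,
     `|f y - f x - L (y - x)| <= e * `|y - x|) ->
  differentiable f x /\ 'd f x = L :> (V -> W).
Proof.
move=> cL H.
have H' : f \o shift x = cst (f x) + L +o_ (0 : V) id.
  apply/eqaddoP => e e0; have := H e e0; rewrite (near_shift 0 x).
  apply: filterS => h /=.
  by rewrite !fctE /= subr0 addrK opprD addrA.
have E : 'd f x = L :> (V -> W) by exact: diff_unique.
by split=> //; apply/diff_locallyP; rewrite E.
Qed.

Lemma near_differentiable (V W : normedModType R) (f g : V -> W) x :
  (\forall y \near x, f y = g y) -> differentiable f x ->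
  differentiable g x /\ 'd g x = 'd f x :> (V -> W).
Proof.
move=> fg df; have fx := nbhs_singleton fg.
apply: dist_differentiable => [|e e0]; first exact: diff_continuous.
near=> y; rewrite -fx -(near fg y) //; near: y.
exact: differentiable_dist.
Unshelve. all: end_near. Qed.

Lemma cvg_mx (T : Type) (F : set_system T) {FF : Filter F} a b
    (f : T -> 'M[R]_(a, b)) (l : 'M[R]_(a, b)) :
  (forall i j, f x i j @[x --> F] --> l i j) -> f x @[x --> F] --> l.
Proof.
move=> H; apply/cvgrPdist_le => e e0; near=> x.
rewrite /Num.Def.normr/= mx_normrE (bigmax_le _ (ltW e0))//= => i _.
rewrite !mxE; move: i; near: x; apply: filter_forall => /= -[i j].
by have /cvgrPdist_le/(_ e e0) := H i j.
Unshelve. all: end_near. Qed.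

Lemma mulmx_continuous a b c :
  continuous (fun p : 'M[R]_(a,b) * 'M[R]_(b,c) => p.1 *m p.2).
Proof.
move=> [p q]; apply: cvg_mx => i j /=.
under eq_fun do rewrite mxE.
rewrite mxE; apply: cvg_big => [|k _]; first exact: add_continuous.
apply: cvgM.
  by apply: (@cvg_comp _ _ _ _ (fun N : 'M[R]_(a,b) => N i k) _ _ _ cvg_fst); exact: coord_continuous.
by apply: (@cvg_comp _ _ _ _ (fun N : 'M[R]_(b,c) => N k j) _ _ _ cvg_snd); exact: coord_continuous.
Qed.

Lemma derive_bilinear (V U1 U2 W : normedModType R)
    (B : {bilinear U1 -> U2 -> W}) (f : V -> U1) (g : V -> U2) x :
  continuous (fun p => B p.1 p.2) ->
  differentiable f x -> differentiable g x ->
  differentiable (fun y => B (f y) (g y)) x /\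
  forall v, 'D_v (fun y => B (f y) (g y)) x = B ('D_v f x) (g x) + B (f x) ('D_v g x).
Proof.
move=> cB df dg.
have db := @differentiable_bilin R _ _ _ B (f x, g x) cB.
have dp := differentiable_pair df dg.
have dc := differentiable_comp dp db.
split=> // v.
rewrite deriveE // (_ : (fun y => _) = (fun p => B p.1 p.2) \o (fun y => (f y, g y))) //.
rewrite diff_comp //= diff_pair // diff_bilin //=.
by rewrite !deriveE // addrC.
Qed.

Lemma derive_linear (V W W' : normedModType R) (L : {linear W -> W'})
    (f : V -> W) x : continuous L -> differentiable f x ->
  differentiable (L \o f) x /\ forall v, 'D_v (L \o f) x = L ('D_v f x).
Proof.
move=> cL df; have dL := linear_differentiable (f x) cL.
have dc := differentiable_comp df dL; split=> // v.
by rewrite !deriveE // (diff_comp df dL) /= (diff_lin (f x) cL).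
Qed.

(** Scaling and entries, packaged as (bi)linear maps so that the rules for
    bilinear and linear maps apply to them. *)
Lemma scale_bilinear (W : normedModType R) : exists B : {bilinear R -> W -> W},
  continuous (fun p => B p.1 p.2) /\ forall a w, B a w = a *: w.
Proof.
have lin : bilinear_for
    (GRing.Scale.Law.clone _ _ *:%R _) (GRing.Scale.Law.clone _ _ *:%R _)
    (fun (a : R) (w : W) => a *: w).
  split=> [u'|u] a x y /=; first by rewrite scalerDl scalerA.
  by rewrite scalerDr !scalerA mulrC.
pose BM := bilinear_isBilinear.Build R R W W _ _ _ lin.
pose B : {bilinear R -> W -> W} := HB.pack (fun (a : R) (w : W) => a *: w) BM.
by exists B; split=> //; exact: scale_continuous.
Qed.

End Differential.

(** * Smooth functions *)

Section Smooth.
Context {R : realType} {k : nat}.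
Implicit Types (U V : set 'rV[R]_k).

(** Counting orders turns each closure property of smooth functions into an
    induction: the product and chain rules express a first derivative through
    functions that are smooth up to one order less. *)
Fixpoint smooth_upto n (W : normedModType R) U (f : 'rV[R]_k -> W) : Prop :=
  (forall x, U x -> differentiable f x) /\
  if n is n'.+1 then forall v, smooth_upto n' U ('D_v f) else True.

Lemma smooth_openP (W : normedModType R) U (f : 'rV[R]_k -> W) :
  smooth_open U f <-> forall n, smooth_upto n U f.
Proof.
split=> [sf n|sf s].
  elim: n f sf => [|n IH] f sf; (split; first exact: (sf [::])) => // v.
  apply: IH => s x Ux.
  by have := sf (rcons s v) x Ux; rewrite /iter_derive foldr_rcons.
elim/last_ind: s f sf => [|s v IH] f sf x Ux; first by have [/(_ x Ux)] := sf 0%N.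
rewrite /iter_derive foldr_rcons; apply: IH => // n.
by have [_] := sf n.+1; apply.
Qed.

Lemma smooth_open_upto n (W : normedModType R) U (f : 'rV[R]_k -> W) :
  smooth_open U f -> smooth_upto n U f.
Proof. by move=> /smooth_openP. Qed.

Lemma smooth_open_differentiable (W : normedModType R) U (f : 'rV[R]_k -> W) x :
  smooth_open U f -> U x -> differentiable f x.
Proof. by move=> /(_ [::]); apply. Qed.

Lemma smooth_open_derive (W : normedModType R) U (f : 'rV[R]_k -> W) v :
  smooth_open U f -> smooth_open U ('D_v f).
Proof.
move=> sf s x Ux; have := sf (rcons s v) x Ux.
by rewrite /iter_derive foldr_rcons.
Qed.

Lemma smooth_uptoS n (W : normedModType R) U (f : 'rV[R]_k -> W) :
  smooth_upto n.+1 U f -> smooth_upto n U f.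
Proof.
elim: n f => [|n IH] f [df Df]; split=> // v; exact: IH.
Qed.

Lemma eq_smooth_upto n (W : normedModType R) U (f g : 'rV[R]_k -> W) :
  open U -> (forall y, U y -> f y = g y) ->
  smooth_upto n U f -> smooth_upto n U g.
Proof.
move=> oU; elim: n f g => [|n IH] f g fg [df Df];
  (split; [by move=> x Ux;
    have [] := near_differentiable (filterS fg (open_near oU Ux)) (df x Ux)|])
  => // v.
apply: IH (Df v) => y Uy; apply: near_eq_derive.
exact: filterS (open_near oU Uy).
Qed.

Lemma eq_smooth_open (W : normedModType R) U (f g : 'rV[R]_k -> W) :
  open U -> (forall y, U y -> f y = g y) -> smooth_open U f -> smooth_open U g.
Proof.
by move=> oU fg /smooth_openP sf; apply/smooth_openP => n;
  exact: eq_smooth_upto (sf n).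
Qed.

Lemma sub_smooth_open (W : normedModType R) U V (f : 'rV[R]_k -> W) :
  U `<=` V -> smooth_open V f -> smooth_open U f.
Proof. by move=> UV sf s x /UV; exact: sf. Qed.

Lemma smooth_upto_cst n (W : normedModType R) U (w : W) :
  smooth_upto n U (cst w).
Proof.
elim: n w => [|n IH] w;
  (split; [by move=> x _; exact: differentiable_cst|]) => // v.
have -> : 'D_v (cst w) = cst (0 : W) by apply/funext => x; rewrite derive_cst.
exact: IH.
Qed.

Lemma smooth_upto_add n (W : normedModType R) U (f g : 'rV[R]_k -> W) :
  open U -> smooth_upto n U f -> smooth_upto n U g ->
  smooth_upto n U (fun y => f y + g y).
Proof.
move=> oU; elim: n f g => [|n IH] f g [df Df] [dg Dg];
  (split; [by move=> x Ux; apply: differentiableD; [exact: df|exact: dg]|]) => // v.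
apply: eq_smooth_upto (IH _ _ (Df v) (Dg v)) => // y Uy.
by rewrite deriveD //; apply: diff_derivable; [exact: df|exact: dg].
Qed.

Lemma smooth_upto_linear n (W W' : normedModType R) (L : {linear W -> W'}) U
    (f : 'rV[R]_k -> W) :
  open U -> continuous L -> smooth_upto n U f -> smooth_upto n U (L \o f).
Proof.
move=> oU cL; have dL w : differentiable L w by exact: linear_differentiable.
elim: n f => [|n IH] f [df Df];
  (split; [by move=> x Ux; apply: differentiable_comp => //; exact: df|]) => // v.
apply: eq_smooth_upto (IH _ (Df v)) => // y Uy /=.
by have [_ ->] := derive_linear cL (df y Uy).
Qed.

Lemma smooth_upto_bilinear n (U1 U2 W : normedModType R)
    (B : {bilinear U1 -> U2 -> W}) U (f : 'rV[R]_k -> U1) (g : 'rV[R]_k -> U2) :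
  continuous (fun p => B p.1 p.2) -> open U ->
  smooth_upto n U f -> smooth_upto n U g ->
  smooth_upto n U (fun y => B (f y) (g y)).
Proof.
move=> cB oU; elim: n f g => [|n IH] f g sf sg;
  (split; [by move=> x Ux; have [] := derive_bilinear cB (sf.1 x Ux) (sg.1 x Ux)|]) => // v.
have H := smooth_upto_add oU (IH _ _ (sf.2 v) (smooth_uptoS sg))
    (IH _ _ (smooth_uptoS sf) (sg.2 v)).
apply: eq_smooth_upto H => // y Uy /=.
by have [_ ->] := derive_bilinear cB (sf.1 y Uy) (sg.1 y Uy).
Qed.

Lemma smooth_upto_sum n (W : normedModType R) U l (f : 'I_l -> 'rV[R]_k -> W) :
  open U -> (forall i, smooth_upto n U (f i)) ->
  smooth_upto n U (fun y => \sum_i f i y).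
Proof.
move=> oU sf; elim: (index_enum _) => [|i s IH].
  apply: eq_smooth_upto (smooth_upto_cst n U (0 : W)) => // y _ /=.
  by rewrite big_nil.
apply: eq_smooth_upto (smooth_upto_add oU (sf i) IH) => // y _.
by rewrite big_cons.
Qed.

Lemma coord_linear a b (i : 'I_a) (j : 'I_b) :
  exists L : {linear 'M[R]_(a, b) -> R}, continuous L /\ forall N, L N = N i j.
Proof.
have lin : linear (fun N : 'M[R]_(a, b) => N i j) by move=> c M N; rewrite !mxE.
pose LM := GRing.isLinear.Build _ _ _ _ _ lin.
pose L : {linear 'M[R]_(a, b) -> R} := HB.pack (fun N : 'M[R]_(a, b) => N i j) LM.
by exists L; split=> //; exact: coord_continuous.
Qed.

End Smooth.

Section SmoothComp.
Context {R : realType} {k l : nat}.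

Lemma derive_comp_sum (W : normedModType R) (f : 'rV[R]_k -> 'rV[R]_l)
    (g : 'rV[R]_l -> W) x v :
  differentiable f x -> differentiable g (f x) ->
  'D_v (g \o f) x = \sum_j ('D_v f x) 0 j *: 'D_(delta_mx 0 j) g (f x).
Proof.
move=> df dg; rewrite deriveE; last exact: differentiable_comp.
rewrite (diff_comp df dg) /= -(deriveE _ df) [X in 'd g (f x) X]row_sum_delta linear_sum.
by apply: eq_bigr => j _; rewrite linearZ /= -(deriveE _ dg).
Qed.

Lemma smooth_upto_comp n (W : normedModType R) (U : set 'rV[R]_k)
    (V : set 'rV[R]_l) (f : 'rV[R]_k -> 'rV[R]_l) (g : 'rV[R]_l -> W) :
  open U -> (forall y, U y -> V (f y)) ->
  smooth_upto n U f -> smooth_upto n V g -> smooth_upto n U (g \o f).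
Proof.
move=> oU UV; elim: n W g => [|n IH] W g sf sg;
  (split; [by move=> x Ux; apply: differentiable_comp;
    [exact: sf.1|exact: sg.1 (UV _ Ux)]|]) => // v.
have [B [cB BE]] := scale_bilinear W.
have H : smooth_upto n U (fun y =>
  \sum_j B (('D_v f y) 0 j) (('D_(delta_mx 0 j) g \o f) y)).
  apply: smooth_upto_sum => // j; apply: smooth_upto_bilinear => //.
    have [L [cL LE]] := @coord_linear R _ _ (0 : 'I_1) j.
    apply: eq_smooth_upto (smooth_upto_linear oU cL (sf.2 v)) => // y _ /=.
    by rewrite LE.
  apply: IH; [exact: smooth_uptoS|exact: sg.2].
apply: eq_smooth_upto H => // y Uy.
rewrite derive_comp_sum; [|exact: sf.1|exact: sg.1 (UV _ Uy)].
by apply: eq_bigr => j _; rewrite BE.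
Qed.

End SmoothComp.

Section SmoothOpen.
Context {R : realType} {k : nat}.
Implicit Types (U V : set 'rV[R]_k).

(** A function inherits smoothness from its first derivatives, so a primitive
    of a smooth 1-form need only be differentiated once by hand. *)
Lemma smooth_open_primitive (W : normedModType R) U (f : 'rV[R]_k -> W)
    (h : 'rV[R]_k -> 'rV[R]_k -> W) :
  open U -> (forall x, U x -> differentiable f x) ->
  (forall v, smooth_open U (h v)) ->
  (forall v x, U x -> 'D_v f x = h v x) -> smooth_open U f.
Proof.
move=> oU df sh Df; apply/smooth_openP => -[|n]; split=> // v.
by apply: eq_smooth_upto (iffLR (smooth_openP _ _) (sh v) n) => // x /Df.
Qed.

Lemma smooth_on_open (W : normedModType R) (A : set 'rV[R]_k)
    (f : 'rV[R]_k -> W) : open A -> smooth_on A f <-> smooth_open A f.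
Proof.
move=> oA; split=> [sf s x Ax|sf x Ax]; last by exists A, f.
have [U [g [oU Ux sg fg]]] := sf x Ax.
have : smooth_open (A `&` U) f.
  apply: (@eq_smooth_open _ _ _ _ g) => [|y [/fg H /H]//|]; first exact: openI.
  by apply: sub_smooth_open sg => y [].
by apply.
Qed.

Lemma smooth_on_local (W : normedModType R) (A : set 'rV[R]_k)
    (f : 'rV[R]_k -> W) :
  (forall x, A x -> exists B g, [/\ smooth_on B g, B x,
     (\forall y \near x, A y -> B y) & forall y, A y -> B y -> f y = g y]) ->
  smooth_on A f.
Proof.
move=> H x Ax; have [B [g [sg Bx AB fg]]] := H x Ax.
have [U [g' [oU Ux sg' gg']]] := sg x Bx.
have : nbhs x [set y | A y -> B y] by exact: AB.
rewrite nbhsE => -[V [oV Vx] VB].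
exists (U `&` V), g'; split=> [|//||y Ay [Uy Vy]]; first exact: openI.
  by apply: sub_smooth_open sg' => y [].
by rewrite fg ?gg' //; exact: VB.
Qed.

Lemma sub_smooth_on (W : normedModType R) (A B : set 'rV[R]_k)
    (f : 'rV[R]_k -> W) : A `<=` B -> smooth_on B f -> smooth_on A f.
Proof.
move=> AB sf x /AB Bx; have [U [g [oU Ux sg fg]]] := sf x Bx.
by exists U, g; split=> // y /AB; exact: fg.
Qed.

Lemma eq_smooth_on (W : normedModType R) (A : set 'rV[R]_k)
    (f g : 'rV[R]_k -> W) :
  (forall x, A x -> f x = g x) -> smooth_on A f -> smooth_on A g.
Proof.
move=> fg sf x Ax; have [U [h [oU Ux sh fh]]] := sf x Ax.
by exists U, h; split=> // y Ay Uy; rewrite -fg ?fh.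
Qed.

Lemma smooth_on_cst (W : normedModType R) A (w : W) : smooth_on A (fun _ : 'rV[R]_k => w).
Proof.
move=> x Ax; exists setT, (cst w); split=> //; first exact: openT.
by apply/smooth_openP => n; exact: smooth_upto_cst.
Qed.

Lemma smooth_on_add (W : normedModType R) A (f g : 'rV[R]_k -> W) :
  smooth_on A f -> smooth_on A g -> smooth_on A (fun x => f x + g x).
Proof.
move=> sf sg x Ax; have [U [f' [oU Ux sf' ff']]] := sf x Ax.
have [V [g' [oV Vx sg' gg']]] := sg x Ax.
exists (U `&` V), (fun x => f' x + g' x); split=> [|//||y Ay [Uy Vy]].
- exact: openI.
- apply/smooth_openP => n; apply: smooth_upto_add; first exact: openI.
    by apply/smooth_open_upto; apply: sub_smooth_open sf' => y [].
  by apply/smooth_open_upto; apply: sub_smooth_open sg' => y [].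
- by rewrite ff' ?gg'.
Qed.

Lemma smooth_on_linear (W W' : normedModType R) (L : {linear W -> W'}) A
    (f : 'rV[R]_k -> W) :
  continuous L -> smooth_on A f -> smooth_on A (L \o f).
Proof.
move=> cL sf x Ax; have [U [f' [oU Ux sf' ff']]] := sf x Ax.
exists U, (L \o f'); split=> // [|y Ay Uy /=]; last by rewrite ff'.
by apply/smooth_openP => n; apply: smooth_upto_linear => //; apply/smooth_open_upto.
Qed.

Lemma smooth_on_opp (W : normedModType R) A (f : 'rV[R]_k -> W) :
  smooth_on A f -> smooth_on A (fun x => - f x).
Proof. by apply: (@smooth_on_linear _ _ -%R); exact: opp_continuous. Qed.

Lemma smooth_on_mulmx a b c A (f : 'rV[R]_k -> 'M[R]_(a, b))
    (g : 'rV[R]_k -> 'M[R]_(b, c)) :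
  smooth_on A f -> smooth_on A g -> smooth_on A (fun x => f x *m g x).
Proof.
move=> sf sg x Ax; have [U [f' [oU Ux sf' ff']]] := sf x Ax.
have [V [g' [oV Vx sg' gg']]] := sg x Ax.
exists (U `&` V), (fun x => f' x *m g' x); split=> [|//||y Ay [Uy Vy]].
- exact: openI.
- apply/smooth_openP => n.
  apply: (@smooth_upto_bilinear _ _ _ _ _ _ (mulmx : {bilinear _ -> _ -> _})).
  + exact: mulmx_continuous.
  + exact: openI.
  + by apply/smooth_open_upto; apply: sub_smooth_open sf' => y [].
  + by apply/smooth_open_upto; apply: sub_smooth_open sg' => y [].
- by rewrite ff' ?gg'.
Qed.

Lemma trmx_continuous a b : continuous (@trmx R a b).
Proof.
move=> M; apply: (@cvg_mx _ _ (nbhs M)) => i j; under eq_fun do rewrite mxE.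
by rewrite mxE; exact: coord_continuous.
Qed.

Lemma smooth_on_trmx a b A (f : 'rV[R]_k -> 'M[R]_(a, b)) :
  smooth_on A f -> smooth_on A (fun x => (f x)^T).
Proof. by apply: (@smooth_on_linear _ _ trmx); exact: trmx_continuous. Qed.

Lemma smooth_on_coord a b A (f : 'rV[R]_k -> 'M[R]_(a, b)) i j :
  smooth_on A f -> smooth_on A (fun x => f x i j).
Proof.
have [L [cL LE]] := @coord_linear R a b i j.
move=> sf; have H := smooth_on_linear cL sf.
by apply: eq_smooth_on H => x _ /=; rewrite LE.
Qed.

Lemma smooth_on_derive (W : normedModType R) A (f : 'rV[R]_k -> W) v :
  open A -> smooth_on A f -> smooth_on A ('D_v f).
Proof. by move=> oA /smooth_on_open H; apply/smooth_on_open/smooth_open_derive/H. Qed.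

Lemma smooth_on_sum (W : normedModType R) A l (f : 'I_l -> 'rV[R]_k -> W) :
  (forall i, smooth_on A (f i)) -> smooth_on A (fun y => \sum_i f i y).
Proof.
move=> sf; elim: (index_enum _) => [|i s IH].
  by apply: eq_smooth_on (@smooth_on_cst _ A 0) => x _; rewrite big_nil.
by apply: eq_smooth_on (smooth_on_add (sf i) IH) => y _; rewrite big_cons.
Qed.

Lemma row_jacobian l (f : 'rV[R]_k -> 'rV[R]_l) x i :
  differentiable f x -> row i ('J f x) = 'D_(delta_mx 0 i) f x.
Proof. by move=> df; rewrite deriveEjacobian // rowE. Qed.

Lemma smooth_on_differentiable (W : normedModType R) A (f : 'rV[R]_k -> W) x :
  open A -> smooth_on A f -> A x -> differentiable f x.
Proof. by move=> oA /(smooth_on_open _ oA); exact: smooth_open_differentiable. Qed.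

End SmoothOpen.

(** Chart expressions of families of maps live on [0,1] times an open set, and
    chart expressions of composites are composites of these; the extensions
    compose because smooth functions are continuous. *)
Lemma smooth_on_comp (R : realType) k l (W : normedModType R)
    (A : set 'rV[R]_k) (B : set 'rV[R]_l) f (g : 'rV[R]_l -> W) :
  smooth_on A f -> smooth_on B g -> (forall x, A x -> B (f x)) ->
  smooth_on A (g \o f).
Proof.
move=> sf sg AB x Ax; have [U [f' [oU Ux sf' ff']]] := sf x Ax.
have [V [g' [oV Vx sg' gg']]] := sg (f x) (AB x Ax).
have cf' y : U y -> {for y, continuous f'}.
  by move=> Uy; apply: differentiable_continuous; exact: smooth_open_differentiable sf' Uy.
have oW : open (U `&` f' @^-1` V).
  rewrite openE => y [Uy Vy].
  have ny : nbhs y U by exact: open_near oU Uy.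
  have nV : nbhs (f' y) V by exact: open_near oV Vy.
  exact: filterI ny (cf' y Uy V nV).
exists (U `&` f' @^-1` V), (g' \o f'); split=> //.
- by split=> //=; rewrite -ff'.
- apply/smooth_openP => n; apply: (@smooth_upto_comp _ _ _ _ _ _ V) => //.
  + by move=> y [].
  + by apply/smooth_open_upto; apply: sub_smooth_open sf' => y [].
  + exact/smooth_open_upto.
- by move=> y Ay [Uy /= Vy]; rewrite -ff' // -gg' ?ff' //; rewrite -ff' //; exact: AB.
Qed.

(** * Lines, mean values and mixed derivatives *)

Section Lines.
Context {R : realType} {V : normedModType R}.

Lemma derive_line (W : normedModType R) (f : V -> W) (x v : V) (t : R) :
  derivable f (x + t *: v) v ->
  is_derive t 1 (fun s : R => f (x + s *: v)) ('D_v f (x + t *: v)).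
Proof.
have E : (fun h : R => h^-1 *: (((fun s : R => f (x + s *: v)) \o shift t) (h *: 1)
                         - f (x + t *: v)))
  = (fun h => h^-1 *: ((f \o shift (x + t *: v)) (h *: v) - f (x + t *: v))).
  apply/funext => h; congr (_ *: (_ - _)).
  have h1 : h *: (1 : R^o) = h by rewrite /GRing.scale /= mulr1.
  by rewrite /= [h *: 1]h1 scalerDl addrCA.
by move=> d; split; rewrite /derivable /derive E.
Qed.

Lemma derive_translate (W : normedModType R) (f : V -> W) (y w v : V) :
  derivable f (y + w) v ->
  is_derive y v (fun z => f (z + w)) ('D_v f (y + w)).
Proof.
have E : (fun h : R => h^-1 *: (((fun z => f (z + w)) \o shift y) (h *: v)
                         - f (y + w)))
  = (fun h => h^-1 *: ((f \o shift (y + w)) (h *: v) - f (y + w))).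
  by apply/funext => h; congr (_ *: (_ - _)); rewrite /= addrA.
by move=> d; split; rewrite /derivable /derive E.
Qed.

Lemma derive_scale (W : normedModType R) (f : V -> W) (y v : V) (h : R) :
  differentiable f y -> 'D_(h *: v) f y = h *: 'D_v f y.
Proof. by move=> df; rewrite !deriveE // linearZ. Qed.

Lemma mvt_line (f : V -> R) (x v : V) :
  (forall t : R, 0 <= t <= 1 -> derivable f (x + t *: v) v) ->
  exists2 t : R, 0 <= t <= 1 & f (x + v) - f x = 'D_v f (x + t *: v).
Proof.
move=> df; pose g (s : R) := f (x + s *: v).
have dg (t : R) : 0 <= t <= 1 -> is_derive t 1 g ('D_v f (x + t *: v)).
  by move=> /df; exact: derive_line.
have I (t : R) : t \in `]0, 1[ -> is_derive t 1 g ('D_v f (x + t *: v)).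
  by rewrite in_itv /= => /andP[/ltW t0 /ltW t1]; apply: dg; rewrite t0.
have C : {within `[0, 1], continuous g}.
  apply: derivable_within_continuous => t; rewrite in_itv /= => /dg H.
  exact: ex_derive.
have [t] := MVT_segment ler01 I C.
rewrite in_itv /= /g scale1r scale0r addr0 subr0 mulr1 => t01 E.
by exists t.
Qed.

Lemma ball_line (x y z : V) (r t : R) : ball x r y -> ball x r z ->
  0 <= t <= 1 -> ball x r (y + t *: (z - y)).
Proof.
rewrite -ball_normE /= => xy xz /andP[t0 t1].
have -> : x - (y + t *: (z - y)) = (1 - t) *: (x - y) + t *: (x - z).
  have -> : x - z = (x - y) + (y - z) by rewrite addrA addrNK.
  rewrite scalerBl scale1r (scalerDr t (x - y)) [RHS]addrA addrNK.
  by rewrite opprD addrA -scalerN opprB.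
apply: le_lt_trans (ler_normD _ _) _; rewrite !normrZ.
rewrite (ger0_norm t0) (@ger0_norm _ (1 - t)) ?subr_ge0 //.
have [t1'|] := ltP t 1; first nra.
nra.
Qed.

Lemma ball_const (f : V -> R) (x : V) (r : R) :
  (forall y, ball x r y -> differentiable f y) ->
  (forall y v, ball x r y -> 'D_v f y = 0) ->
  forall y z, ball x r y -> ball x r z -> f y = f z.
Proof.
move=> df Df y z xy xz; apply/esym/eqP; rewrite -subr_eq0 -{1}(subrKC y z).
have I (t : R) : 0 <= t <= 1 -> derivable f (y + t *: (z - y)) (z - y).
  by move=> t01; apply: diff_derivable; apply: df; exact: ball_line.
have [t t01 ->] := mvt_line I.
by rewrite Df //; exact: ball_line.
Qed.

End Lines.

Section Schwarz.
Context {R : realType} {V : normedModType R}.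

(** Apply the mean value theorem to [z |-> f (z + h v) - f z] along [h u], then
    the differentiability of the derivative along [u].  The second difference
    is symmetric in [u] and [v], whence the symmetry of mixed derivatives
    below, which asks only that both first derivatives be differentiable at
    the point. *)
Lemma second_difference (f : V -> R) (U : set V) x u v (e : R) :
  open U -> U x -> (forall y, U y -> differentiable f y) ->
  differentiable ('D_u f) x -> 0 < e ->
  \forall h \near (0 : R)^'+,
    `|f (x + h *: u + h *: v) - f (x + h *: u) - f (x + h *: v) + f x
      - h ^+ 2 * 'D_v ('D_u f) x| <= h ^+ 2 * e.
Proof.
move=> oU Ux df ddf e0.
pose n := `|u| + `|v|.
have n0 : 0 <= n by rewrite addr_ge0.
(* The error is at most [h * n * e'] at each of the two end points. *)
pose e' := e / (n + n + 1).
have e'0 : 0 < e' by rewrite divr_gt0 // ltr_wpDl ?addr_ge0.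
have := differentiable_dist ddf e'0.
have := open_near oU Ux.
move=> /nbhs_ballP[r1 /= r10 H1] /nbhs_ballP[r2 /= r20 H2].
have rn0 : 0 < Num.min r1 r2 / (n + 1).
  by rewrite divr_gt0 ?lt_min ?r10 ?r20 // ltr_wpDl.
near=> h.
have h0 : 0 < h by near: h; exact: nbhs_right_gt.
have hr : h < Num.min r1 r2 / (n + 1) by near: h; exact: nbhs_right_lt.
have inball (s t : R) : 0 <= s <= 1 -> 0 <= t <= 1 ->
    U (x + s *: (h *: u) + t *: (h *: v)) /\
    `|'D_u f (x + s *: (h *: u) + t *: (h *: v)) - 'D_u f x
      - 'd ('D_u f) x (s *: (h *: u) + t *: (h *: v))| <= e' * (h * n).
  move=> /andP[s0 s1] /andP[t0 t1].
  set w := s *: (h *: u) + t *: (h *: v).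
  have wn : `|w| <= h * n.
    apply: le_trans (ler_normD _ _) _; rewrite !normrZ (ger0_norm s0) (ger0_norm t0).
    rewrite (gtr0_norm h0) mulrDr; apply: lerD; rewrite -[leRHS]mul1r; apply: ler_wpM2r => //.
      by rewrite mulr_ge0 // ltW.
    by rewrite mulr_ge0 // ltW.
  have wr : `|w| < Num.min r1 r2.
    apply: le_lt_trans wn _; move: hr; rewrite ltr_pdivlMr ?ltr_wpDl //.
    apply: le_lt_trans; rewrite ler_pM2l // lerDl; exact: ler01.
  rewrite -addrA; split.
    apply: H1; rewrite -ball_normE /= opprD addrA subrr add0r normrN.
    by rewrite (lt_le_trans wr) // ge_min lexx.
  have -> : 'd ('D_u f) x w = 'd ('D_u f) x ((x + w) - x) by rewrite addrC addKr.
  have H := H2 (x + w); apply: (le_trans (H _)).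
    rewrite -ball_normE /= opprD addrA subrr add0r normrN.
    by rewrite (lt_le_trans wr) // ge_min lexx orbT.
  by rewrite [x + w]addrC addrK ler_pM2l.
pose F z := f (z + h *: v) - f z.
have dF (t : R) : 0 <= t <= 1 -> derivable F (x + t *: (h *: u)) (h *: u) /\
   'D_(h *: u) F (x + t *: (h *: u)) =
   h * ('D_u f (x + t *: (h *: u) + h *: v) - 'D_u f (x + t *: (h *: u))).
  move=> t01.
  have i01 : 0 <= (0 : R) <= 1 by rewrite lexx ler01.
  have i11 : 0 <= (1 : R) <= 1 by rewrite lexx ler01.
  have [U1 _] := inball t 1 t01 i11; have [U0 _] := inball t 0 t01 i01.
  rewrite scale1r in U1; rewrite scale0r addr0 in U0.
  have d1 := derive_translate (@diff_derivable _ _ _ f _ (h *: u) (df _ U1)).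
  have d0 : is_derive (x + t *: (h *: u)) (h *: u) f _ :=
    derivableP (@diff_derivable _ _ _ f _ (h *: u) (df _ U0)).
  have dF := is_deriveB d1 d0; split; first exact: ex_derive.
  rewrite (@derive_val _ _ _ _ _ _ _ dF) !derive_scale; [|exact: df..].
  by rewrite -scalerBr.
have [t t01] := mvt_line (fun t H => (dF t H).1).
have [_ ->] := dF t t01.
have i01 : 0 <= (0 : R) <= 1 by rewrite lexx ler01.
have i11 : 0 <= (1 : R) <= 1 by rewrite lexx ler01.
have [_] := inball t 1 t01 i11; have [_] := inball t 0 t01 i01.
rewrite !scale1r !scale0r !addr0 (linearD _ (t *: (h *: u)) (h *: v)) /=.
have -> : 'd ('D_u f) x (h *: v) = h * 'd ('D_u f) x v by rewrite linearZ.
rewrite -(deriveE v ddf).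
rewrite /F.
set B := 'D_u f _; set C := 'D_u f x; set A := 'D_u f _; set L := 'd _ _ _.
set D := 'D_v _ _ => HB HA E.
have -> : f (x + h *: u + h *: v) - f (x + h *: u) - f (x + h *: v) + f x =
   f (x + h *: u + h *: v) - f (x + h *: u) - (f (x + h *: v) - f x) by ring.
rewrite E.
have -> : h * (A - B) - h ^+ 2 * D = h * ((A - C - (L + h * D)) - (B - C - L)).
  by ring.
rewrite normrM (gtr0_norm h0) expr2 -mulrA ler_pM2l //.
apply: le_trans (ler_normB _ _) _; apply: le_trans (lerD HA HB) _.
have -> : e' * (h * n) + e' * (h * n) = h * (e' * (n + n)) by ring.
rewrite ler_pM2l // /e' mulrAC ler_pdivrMr ?ltr_wpDl ?addr_ge0 //.
by rewrite ler_pM2l // lerDl ler01.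
Unshelve. all: end_near. Qed.

Lemma second_difference_bound (S P Q C h e A B : R) : 0 < h ->
  `|S - P - Q + C - h * A| <= h * (e / 2) ->
  `|S - Q - P + C - h * B| <= h * (e / 2) -> `|B - A| <= e.
Proof.
move=> h0 H1 H2; rewrite -(ler_pM2l h0) -{1}(gtr0_norm h0) -normrM.
have -> : h * e = h * (e / 2) + h * (e / 2) by rewrite -mulrDr -splitr.
apply: le_trans (lerD H1 H2); apply: le_trans (ler_normB _ _).
by rewrite le_eqVlt; apply/orP; left; apply/eqP; congr (`| _ |); ring.
Qed.

Lemma derive_sym (f : V -> R) (U : set V) x u v :
  open U -> U x -> (forall y, U y -> differentiable f y) ->
  differentiable ('D_u f) x -> differentiable ('D_v f) x ->
  'D_u ('D_v f) x = 'D_v ('D_u f) x.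
Proof.
move=> oU Ux df ddu ddv; apply/eqP; rewrite -subr_eq0 -normr_eq0.
rewrite eq_le normr_ge0 andbT; apply/ler_addgt0Pr => e e0; rewrite add0r.
have e20 : 0 < e / 2 by rewrite divr_gt0.
have N1 := @second_difference f U x u v (e / 2) oU Ux df ddu e20.
have N2 := @second_difference f U x v u (e / 2) oU Ux df ddv e20.
have N0 := nbhs_right_gt (0 : R).
have [h /= [[h0 H1] H2]] := filter_ex (filterI (filterI N0 N1) N2).
have h20 : 0 < h ^+ 2 by rewrite exprn_gt0.
rewrite [x + h *: v + _]addrAC in H2.
exact: second_difference_bound h20 H1 H2.
Qed.

End Schwarz.

(** * The Poincare lemma *)

Section Integral.
Context {R : realType}.
Local Notation mu := (@lebesgue_measure R).

Lemma within_unit (f : R -> R) :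
  (forall t : R, 0 <= t <= 1 -> {for t, continuous f}) ->
  {within `[0, 1], continuous f}.
Proof.
move=> cf; apply: continuous_in_subspaceT => t.
by rewrite inE /= in_itv /=; exact: cf.
Qed.

Lemma integrable_unit (f : R -> R) :
  (forall t : R, 0 <= t <= 1 -> {for t, continuous f}) ->
  mu.-integrable `[0, 1] (EFin \o f).
Proof.
move=> cf; apply: continuous_compact_integrable; first exact: segment_compact.
exact: within_unit.
Qed.

Lemma integral_derive (f df : R -> R) :
  (forall t : R, 0 <= t <= 1 -> is_derive t 1 f (df t)) ->
  (forall t : R, 0 <= t <= 1 -> {for t, continuous df}) ->
  \int[mu]_(t in `[0, 1]) df t = f 1 - f 0.
Proof.
move=> Df cdf; rewrite /Rintegral (@continuous_FTC2 _ df f) //=.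
- exact: within_unit.
- have cf (t : R) : 0 <= t <= 1 -> {for t, continuous f}.
    by move=> /Df [d _]; exact/differentiable_continuous/derivable1_diffP.
  split.
  + by move=> t; rewrite in_itv /= => /andP[/ltW t0 /ltW t1];
      have [] := Df t; rewrite ?t0.
  + by apply: cvg_at_right_filter; apply: cf; rewrite lexx ler01.
  + by apply: cvg_at_left_filter; apply: cf; rewrite lexx ler01.
- move=> t; rewrite in_itv /= => /andP[/ltW t0 /ltW t1].
  by rewrite derive1E; apply: derive_val; apply: Df; rewrite t0.
Qed.

(** The dominating constant for differentiation under the integral exists near
    [tau = 0] because the derivative is continuous along the compact segment
    [0] times [0,1]. *)
Lemma leibniz_rule (h dh : R -> R -> R) (d : R) : 0 < d ->
  (forall tau t : R, `|tau| < d -> 0 <= t <= 1 ->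
     is_derive tau 1 (h ^~ t) (dh tau t)) ->
  (forall tau t : R, `|tau| < d -> 0 <= t <= 1 -> {for t, continuous (h tau)}) ->
  (forall t : R, 0 <= t <= 1 ->
     {for (0, t), continuous (fun z : R * R => dh z.1 z.2)}) ->
  is_derive (0 : R) (1 : R) (fun tau : R => \int[mu]_(t in `[0, 1]) h tau t)
    (\int[mu]_(t in `[0, 1]) dh 0 t).
Proof.
move=> d0 Dh ch cdh.
have : \forall i \near filter_prod (pinfty_nbhs R) (nbhs (0 : R)),
    `[0, 1] `<=` (fun t => `|dh i.2 t| <= i.1).
  have /compact_near_coveringP := @segment_compact R 0 1.
  apply=> t; rewrite /= in_itv /= => t01.
  have /cvgrPdist_lt/(_ 1 ltr01)[[A B] /= [A0 Bt] AB] := cdh t t01.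
  exists (B, [set i : R * R | `|dh 0 t| + 1 <= i.1 /\ A i.2]) => /=.
    split=> //; exists ([set x | `|dh 0 t| + 1 <= x], A) => /=.
      by split=> //; exact: nbhs_pinfty_ge (num_real _).
    by move=> [x tau] [/= ].
  move=> [t' [x tau]] /= [Bt' [cx Atau]]; apply: le_trans cx.
  have /ltW := AB (tau, t') (conj Atau Bt'); rewrite /= -lerBlDl.
  by apply: le_trans; rewrite distrC; exact: lerB_dist.
move=> [[P Q] /= [P1 Q1] PQ].
have [M [PM M0]] : exists M, P M /\ 0 <= M.
  have [M0 [_ PM0]] := P1; exists (Num.max M0 0 + 1); split.
    by apply: PM0; rewrite ltr_pwDr // le_max lexx.
  by rewrite addr_ge0 // le_max lexx orbT.
have [e e0 eQ] : exists2 e : R, 0 < e & forall tau : R, `|tau| < e -> Q tau.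
  have /nbhs_ballP[e /= e0 eQ] := Q1; exists e => // tau te; apply: eQ.
  by rewrite -ball_normE /= sub0r normrN.
pose s := Num.min d e.
have s0 : 0 < s by rewrite lt_min d0.
have sI (tau : R) : `]- s, s[%classic tau -> `|tau| < d /\ `|tau| < e.
  by rewrite /= in_itv /= -ltr_norml lt_min => /andP[].
have mI : measurable (`[0, 1] : set R) by exact: measurable_itv.
have I0 : `]- s, s[%classic (0 : R) by rewrite /= in_itv /= oppr_lt0 s0.
have intf (tau : R) : `]- s, s[%classic tau -> mu.-integrable `[0, 1] (EFin \o h tau).
  by move=> /sI[td _]; apply: integrable_unit => t t01; exact: ch.
have der (tau t : R) : `]- s, s[%classic tau -> `[0, 1]%classic t -> derivable (h ^~ t) tau 1.
  by move=> /sI[td _]; rewrite /= in_itv /= => /(Dh _ _ td) [].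
have intM : mu.-integrable `[0, 1] (EFin \o (fun=> M)).
  by apply: integrable_unit => t _; exact: cst_continuous.
have partialE (tau t : R) : `]- s, s[%classic tau -> `[0, 1]%classic t -> partial1of2 h tau t = dh tau t.
  move=> /sI[td _]; rewrite /= in_itv /= => t01.
  by rewrite partial1of2E; apply: derive_val; exact: Dh.
have bound (tau t : R) : `]- s, s[%classic tau -> `[0, 1]%classic t -> `|partial1of2 h tau t| <= M.
  move=> Itau It; rewrite partialE //; apply: (PQ (M, tau)) => //; split=> //=.
  by apply: eQ; have [] := sI tau Itau.
have G0 (y : R) : 0 <= (fun=> M) y by exact: M0.
have der0 := @derivable_under_integral R _ _ mu h _ mI 0 (- s) s I0 intf der
  (fun=> M) G0 intM bound.
have der1 := @differentiation_under_integral R _ _ mu h _ mI 0 (- s) s I0 intf der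
  (fun=> M) G0 intM bound.
split; first exact: der0.
rewrite derive1E in der1; rewrite der1.
by apply: eq_Rintegral => t; rewrite inE => It; exact: partialE.
Qed.

End Integral.

Section Poincare.
Context {R : realType} {V : normedModType R}.
Local Notation mu := (@lebesgue_measure R).

Lemma line_derive (W : normedModType R) (f : V -> W) (x v : V) (d : W) :
  is_derive (0 : R) (1 : R) (fun s : R => f (x + s *: v)) d -> is_derive x v f d.
Proof.
have E : (fun h : R => h^-1 *: (((fun s : R => f (x + s *: v)) \o shift 0) (h *: 1)
                         - f (x + 0 *: v)))
  = (fun h => h^-1 *: ((f \o shift x) (h *: v) - f x)).
  apply/funext => h; rewrite scale0r addr0; congr (_ *: (_ - _)).
  have h1 : h *: (1 : R^o) = h by rewrite /GRing.scale /= mulr1.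
  by rewrite /= [h *: 1]h1 addr0 addrC.
by case; rewrite /derivable /derive E => d0 d1; split.
Qed.

Variables (a : V -> V -> R) (y0 : V) (r : R).
Hypothesis lin : forall y c u v, a (c *: u + v) y = c * a u y + a v y.
Hypothesis da : forall v y, ball y0 r y -> differentiable (a v) y.
Hypothesis cda : forall u v y, ball y0 r y -> {for y, continuous ('D_u (a v))}.
Hypothesis sym : forall u v y, ball y0 r y -> 'D_u (a v) y = 'D_v (a u) y.

Definition radial_primitive (y : V) : R :=
  \int[mu]_(t in `[0, 1]) a (y - y0) (y0 + t *: (y - y0)).

(** Differentiating under the integral in direction [v] and using [sym], the
    integrand becomes the derivative in [t] of [t * a v] along the ray, which
    integrates to the value of [a v] at the end point. *)
Lemma radial_primitive_derive y v : ball y0 r y ->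
  is_derive y v radial_primitive (a v y).
Proof.
move=> Ny; apply: line_derive.
have r0 : 0 < r by move: Ny; rewrite -ball_normE /=; exact: le_lt_trans.
have Ny0 : ball y0 r y0 by exact: ballxx.
pose w := y - y0; pose p (tau t : R) := y0 + t *: (w + tau *: v).
pose h (tau t : R) := a (w + tau *: v) (p tau t).
pose dh (tau t : R) := t * 'D_v (a w) (p tau t) +
  (a v (p tau t) + tau * (t * 'D_v (a v) (p tau t))).
have [rho rho0 Hrho] : exists2 e : R, 0 < e & ball y e `<=` ball y0 r.
  have /nbhs_ballP[e /= e0 He] := open_near (ball_open y0 r) Ny.
  by exists e.
pose d := rho / (`|v| + 1).
have v10 : 0 < `|v| + 1 by rewrite ltr_wpDl.
have d0 : 0 < d by rewrite divr_gt0.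
have yN (tau : R) : `|tau| < d -> ball y0 r (y + tau *: v).
  move=> td; apply: Hrho; rewrite -ball_normE /= opprD addrA subrr add0r normrN.
  rewrite normrZ; move: td; rewrite ltr_pdivlMr //; apply: le_lt_trans.
  by rewrite ler_wpM2l // lerDl ler01.
have wE (tau : R) : w + tau *: v = (y + tau *: v) - y0 by rewrite /w addrAC.
have pN (tau t : R) : `|tau| < d -> 0 <= t <= 1 -> ball y0 r (p tau t).
  by move=> /yN H t01; rewrite /p wE; exact: ball_line.
have lin' (tau : R) z : a (w + tau *: v) z = a w z + tau * a v z.
  by rewrite addrC lin addrC.
have aD (u : V) (tau t : R) : `|tau| < d -> 0 <= t <= 1 ->
    is_derive tau 1 (fun s => a u (p s t)) (t * 'D_v (a u) (p tau t)).
  move=> td t01; have Np := pN tau t td t01.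
  have pE s : p s t = (y0 + t *: w) + s *: (t *: v).
    by rewrite /p scalerDr addrA !scalerA [t * s]mulrC.
  have -> : (fun s => a u (p s t)) = (fun s => a u ((y0 + t *: w) + s *: (t *: v))).
    by apply/funext => s; rewrite pE.
  have <- : 'D_(t *: v) (a u) (p tau t) = t * 'D_v (a u) (p tau t).
    exact: derive_scale (da u Np).
  rewrite pE in Np *; apply: derive_line; apply: diff_derivable; exact: da.
have Dh (tau t : R) : `|tau| < d -> 0 <= t <= 1 ->
    is_derive tau 1 (h ^~ t) (dh tau t).
  move=> td t01.
  have -> : h ^~ t = (fun s => a w (p s t)) + (fun s => s * a v (p s t)).
    by apply/funext => s; rewrite /h lin'.
  have D1 := aD w tau t td t01; have D2 := aD v tau t td t01.
  have D3 := is_deriveM (is_derive_id tau 1) D2.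
  apply: is_derive_eq (is_deriveD D1 D3) _.
  by rewrite /dh /GRing.scale /= mulr1 [X in _ + X]addrC.
have ch (tau t : R) : `|tau| < d -> 0 <= t <= 1 -> {for t, continuous (h tau)}.
  move=> td t01; have Np := pN tau t td t01.
  apply/differentiable_continuous/derivable1_diffP.
  have [] := @derive_line R V _ (a (w + tau *: v)) y0 (w + tau *: v) t; last by [].
  by apply: diff_derivable; exact: da.
have cp (t : R) : {for (0, t), continuous (fun z : R * R => p z.1 z.2)}.
  rewrite /p; apply: cvgD; first exact: cvg_cst.
  apply: cvgZ; first exact: cvg_snd.
  by apply: cvgD; [exact: cvg_cst|apply: cvgZr_tmp; exact: cvg_fst].
have cdh (t : R) : 0 <= t <= 1 ->
    {for (0, t), continuous (fun z : R * R => dh z.1 z.2)}.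
  move=> t01; have Np : ball y0 r (p 0 t) by apply: pN; rewrite ?normr0.
  have comp (f : V -> R) : {for p 0 t, continuous f} ->
      f (p z.1 z.2) @[z --> ((0 : R), t)] --> f (p 0 t).
    by move=> cf; apply: (@cvg_comp _ _ _ (fun z : R * R => p z.1 z.2) f _ _ _ (cp t) cf).
  have ca u : {for p 0 t, continuous (a u)}.
    exact: differentiable_continuous (da u Np).
  have c1 : z.1 @[z --> ((0 : R), t)] --> (0 : R) by exact: cvg_fst.
  have c2 : z.2 @[z --> ((0 : R), t)] --> t by exact: cvg_snd.
  have cw := comp ('D_v (a w)) (@cda v w _ Np).
  have cv := comp ('D_v (a v)) (@cda v v _ Np).
  exact: (cvgD (cvgM c2 cw) (cvgD (comp (a v) (ca v)) (cvgM c1 (cvgM c2 cv)))).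
have L := leibniz_rule d0 Dh ch cdh.
have -> : (fun s => radial_primitive (y + s *: v)) =
    (fun tau => \int[mu]_(t in `[0, 1]) h tau t).
  by apply/funext => s; rewrite /radial_primitive -wE.
suff <- : \int[mu]_(t in `[0, 1]) dh 0 t = a v y by [].
have z0 : `|0 : R| < d by rewrite normr0.
pose f (t : R) := t * a v (p 0 t).
have p0 t : p 0 t = y0 + t *: w by rewrite /p scale0r addr0.
have Df (t : R) : 0 <= t <= 1 -> is_derive t 1 f (dh 0 t).
  move=> t01; have Np := pN 0 t z0 t01.
  have D1 : is_derive t 1 (fun s => a v (p 0 s)) ('D_w (a v) (p 0 t)).
    have -> : (fun s => a v (p 0 s)) = (fun s => a v (y0 + s *: w)).
      by apply/funext => s; rewrite p0.
    rewrite p0 in Np *; apply: derive_line; apply: diff_derivable; exact: da.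
  apply: is_derive_eq (is_deriveM (is_derive_id t 1) D1) _.
  by rewrite /dh mul0r addr0 (@sym v w _ Np) /GRing.scale /= mulr1.
have cdf (t : R) : 0 <= t <= 1 -> {for t, continuous (dh 0)}.
  move=> t01.
  have c1 : (fun=> 0) @ t --> (0 : R) by exact: cvg_cst.
  have c2 : id @ t --> (t : R) by exact: cvg_id.
  exact: (cvg_comp (fun s : R => ((0 : R), s)) _ (cvg_pair c1 c2) (cdh t t01)).
rewrite (integral_derive Df cdf) /f mul0r mul1r subr0 p0 scale1r /w.
by rewrite addrC addrNK.
Qed.

End Poincare.

Section MatrixCalculus.
Context {R : realType}.

Lemma derive_entry (V : normedModType R) a b (f : V -> 'M[R]_(a, b)) x i j :
  differentiable f x ->
  differentiable (fun y => f y i j) x /\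
  forall v, 'D_v (fun y => f y i j) x = ('D_v f x) i j.
Proof.
have [L [cL LE]] := @coord_linear R a b i j.
have -> : (fun y => f y i j) = L \o f by apply/funext => y /=; rewrite LE.
by move=> df; have [dL D] := derive_linear cL df; split=> // v; rewrite D LE.
Qed.

Lemma derive_mulmx (V : normedModType R) a b c
   (f : V -> 'M[R]_(a, b)) (g : V -> 'M[R]_(b, c)) x :
  differentiable f x -> differentiable g x ->
  differentiable (fun y => f y *m g y) x /\
  forall v, 'D_v (fun y => f y *m g y) x = 'D_v f x *m g x + f x *m 'D_v g x.
Proof.
exact: (derive_bilinear (B := (mulmx : {bilinear _ -> _ -> _}))
  (@mulmx_continuous R a b c)).
Qed.

Lemma derive_trmx (V : normedModType R) a b (f : V -> 'M[R]_(a, b)) x :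
  differentiable f x ->
  differentiable (fun y => (f y)^T) x /\
  forall v, 'D_v (fun y => (f y)^T) x = ('D_v f x)^T.
Proof. by move=> df; exact: (derive_linear (@trmx_continuous R a b) df). Qed.

Lemma derive_row_sum k (W : normedModType R) (f : 'rV[R]_k -> W) x v :
  differentiable f x -> 'D_v f x = \sum_i v 0 i *: 'D_(delta_mx 0 i) f x.
Proof.
move=> df; rewrite deriveE // [X in 'd f x X]row_sum_delta linear_sum.
by apply: eq_bigr => i _; rewrite linearZ /= deriveE.
Qed.

Lemma mulmx_bound a b c : exists2 C : R, 0 < C &
  forall (M : 'M[R]_(a, b)) (N : 'M[R]_(b, c)), `|M *m N| <= C * `|M| * `|N|.
Proof.
exact: (@bilinear_schwarz _ _ _ _ (mulmx : {bilinear _ -> _ -> _})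
  (@mulmx_continuous R a b c)).
Qed.

Lemma entry_norm a b (M : 'M[R]_(a, b)) i j : `|M i j| <= `|M|.
Proof.
by rewrite [leRHS]/Num.Def.normr /= mx_normrE; exact: (le_bigmax _ _ (i, j)).
Qed.

Lemma derive_sym_mx k a b (f : 'rV[R]_k -> 'M[R]_(a, b)) (U : set 'rV[R]_k) x u v :
  open U -> U x -> smooth_open U f -> 'D_u ('D_v f) x = 'D_v ('D_u f) x.
Proof.
move=> oU Ux sf.
have df y : U y -> differentiable f y := smooth_open_differentiable sf.
have dd w y : U y -> differentiable ('D_w f) y.
  exact: smooth_open_differentiable (smooth_open_derive w sf).
apply/matrixP => i j.
have E w y : U y -> 'D_w (fun y => f y i j) y = ('D_w f y) i j.
  by move=> Uy; have [_ ->] := derive_entry i j (df y Uy).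
have DE w z : 'D_z ('D_w (fun y => f y i j)) x = ('D_z ('D_w f) x) i j.
  rewrite (eq_derive_open z oU Ux (E w)).
  by have [_ ->] := derive_entry i j (dd w x Ux).
have dde w : differentiable ('D_w (fun y => f y i j)) x.
  have [d _] := derive_entry i j (dd w x Ux).
  have [] := near_differentiable (f := fun y => 'D_w f y i j)
    (g := 'D_w (fun y => f y i j)) _ d; last by [].
  by apply: filterS (open_near oU Ux) => y /E ->.
have dfe y : U y -> differentiable (fun y => f y i j) y.
  by move=> Uy; have [] := derive_entry i j (df y Uy).
exact: etrans (esym (DE v u)) (etrans (derive_sym oU Ux dfe (dde u) (dde v)) (DE u v)).
Qed.

(** The radial integral is a primitive along every line; the mean value theorem
    on segments of the ball and the continuity of [a] make it differentiable,
    and then it is smooth because its derivatives are. *)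
Lemma poincare k (y0 : 'rV[R]_k) (r : R) (a : 'rV[R]_k -> 'cV[R]_k) :
  smooth_open (ball y0 r) a ->
  (forall y, ball y0 r y -> forall i j : 'I_k,
     ('D_(delta_mx 0 i) a y) j 0 = ('D_(delta_mx 0 j) a y) i 0) ->
  exists F : 'rV[R]_k -> R, smooth_open (ball y0 r) F /\
    forall y v, ball y0 r y -> 'D_v F y = (v *m a y) 0 0.
Proof.
move=> sa closed_a; pose N := ball y0 r.
have oN : open N := ball_open y0 r.
have da y : N y -> differentiable a y := smooth_open_differentiable sa.
pose al (v y : 'rV[R]_k) : R := (v *m a y) 0 0.
have al_smooth v : smooth_open N (al v).
  apply/(smooth_on_open _ oN)/smooth_on_coord/smooth_on_mulmx.
    exact: smooth_on_cst.
  exact/(smooth_on_open _ oN).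
have al_derive u v y : N y -> 'D_u (al v) y = (v *m 'D_u a y) 0 0.
  move=> Ny; have [d D] := derive_mulmx (differentiable_cst v y) (da y Ny).
  have [_ ->] := derive_entry 0 0 d.
  by rewrite D derive_cst mul0mx add0r.
have lin y c u v : al (c *: u + v) y = c * al u y + al v y.
  by rewrite /al mulmxDl -scalemxAl !mxE.
have al_diff v y : N y -> differentiable (al v) y.
  exact: smooth_open_differentiable (al_smooth v).
have al_cont u v y : N y -> {for y, continuous ('D_u (al v))}.
  move=> Ny; apply: differentiable_continuous.
  exact: (smooth_open_differentiable (smooth_open_derive u (al_smooth v)) Ny).
have al_sym u v y : N y -> 'D_u (al v) y = 'D_v (al u) y.
  move=> Ny; rewrite (al_derive u v y Ny) (al_derive v u y Ny).
  rewrite (derive_row_sum u (da y Ny)).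
  rewrite (derive_row_sum v (da y Ny)) !mulmx_sumr !summxE.
  under eq_bigr => i _ do rewrite -scalemxAr mxE [X in _ * X]mxE mulr_sumr.
  under [RHS]eq_bigr => i _ do rewrite -scalemxAr mxE [X in _ * X]mxE mulr_sumr.
  rewrite exchange_big; apply: eq_bigr => i _; apply: eq_bigr => j _.
  by rewrite mulrCA; congr (_ * (_ * _)); exact: closed_a.
have prim y v : N y -> is_derive y v (radial_primitive al y0) (al v y).
  by move=> Ny; exact: (radial_primitive_derive lin al_diff al_cont al_sym).
have [C C0 HC] := @mulmx_bound 1 k 1.
set F := radial_primitive al y0 in prim.
have dF y : N y -> differentiable F y.
  move=> Ny.
  have lin_al : linear (al ^~ y) by move=> c u v; rewrite lin.
  pose LM := GRing.isLinear.Build _ _ _ _ _ lin_al.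
  pose L : {linear 'rV[R]_k -> R} := HB.pack (al ^~ y) LM.
  have cL : continuous L.
    have -> : (L : _ -> _) = (fun M : 'M[R]_(1, 1) => M 0 0) \o (fun v => v *m a y) by [].
    move=> v; apply: continuous_comp; last exact: coord_continuous.
    apply: differentiable_continuous.
    have dv : differentiable (@id 'rV[R]_k) v by [].
    by have [] := derive_mulmx dv (differentiable_cst (a y) v).
  have [] // := @dist_differentiable _ _ _ F L y cL.
  move=> e e0.
  have ca : a z @[z --> y] --> a y := differentiable_continuous (da y Ny).
  have eC : 0 < e / C by rewrite divr_gt0.
  have near_a : \forall z \near y, `|a y - a z| <= e / C.
    by move/cvgrPdist_le : ca; apply.
  have [d /= d0 Hd] := iffLR (nbhs_ballP _ _) (filterI (open_near oN Ny) near_a).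
  apply/nbhs_ballP; exists d => //= z yz.
  have yy : ball y d y by exact: ballxx.
  have I (t : R) : 0 <= t <= 1 -> derivable F (y + t *: (z - y)) (z - y).
    by move=> t01; have [Nt _] := Hd _ (ball_line yy yz t01);
      have [] := prim _ (z - y) Nt.
  have [t t01 E] := mvt_line I.
  have [Nt at_] := Hd _ (ball_line yy yz t01).
  rewrite subrKC in E; rewrite E (@derive_val _ _ _ _ _ _ _ (prim _ _ Nt)) /=.
  set z' := y + t *: (z - y) in at_ *.
  have -> : al (z - y) z' - al (z - y) y = ((z - y) *m (a z' - a y)) 0 0.
    by rewrite /al mulmxBr !mxE.
  apply: le_trans (entry_norm _ _ _) _; apply: le_trans (HC _ _) _.
  rewrite distrC in at_; rewrite mulrAC ler_wpM2r //.
  by rewrite mulrC -ler_pdivlMr.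
exists F; split; last by move=> y v Ny; exact: (@derive_val _ _ _ _ _ _ _ (prim y v Ny)).
apply: (smooth_open_primitive oN dF al_smooth) => v y Ny.
exact: (@derive_val _ _ _ _ _ _ _ (prim y v Ny)).
Qed.


End MatrixCalculus.

(** * Maps and functions in charts *)

Section Jacobian.
Context {R : realType}.

Lemma near_jacobian k l (f g : 'rV[R]_k -> 'rV[R]_l) x :
  (\forall y \near x, f y = g y) -> differentiable f x -> 'J f x = 'J g x.
Proof.
move=> fg df; have [dg _] := near_differentiable fg df.
apply/row_matrixP => i; rewrite [LHS](row_jacobian i df) [RHS](row_jacobian i dg).
exact: near_eq_derive.
Qed.

Lemma jacobian_comp k l n (f : 'rV[R]_k -> 'rV[R]_l) (g : 'rV[R]_l -> 'rV[R]_n) x :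
  differentiable f x -> differentiable g (f x) ->
  'J (g \o f) x = 'J f x *m 'J g (f x).
Proof.
move=> df dg; apply/row_matrixP => i.
have dgf := differentiable_comp df dg; rewrite [LHS](row_jacobian i dgf).
rewrite row_mul [X in _ = X *m _](row_jacobian i df) -[RHS](deriveEjacobian _ dg).
by rewrite [LHS](deriveE _ dgf) (diff_comp df dg) [RHS](deriveE _ dg) /= (deriveE _ df).
Qed.

Lemma jacobian_id k (x : 'rV[R]_k) : 'J id x = 1%:M.
Proof.
have d : differentiable (@id 'rV[R]_k) x by [].
by apply/row_matrixP => i; rewrite (row_jacobian i d) derive_id row1.
Qed.

Definition gradient k (f : 'rV[R]_k -> R) (x : 'rV[R]_k) : 'cV[R]_k :=
  \col_i 'D_(delta_mx 0 i) f x.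

Lemma mul_gradient k (f : 'rV[R]_k -> R) x v :
  differentiable f x -> (v *m gradient f x) 0 0 = 'D_v f x.
Proof.
move=> df; rewrite (derive_row_sum v df) mxE; apply: eq_bigr => i _.
by rewrite mxE.
Qed.

Lemma gradient_comp k l (f : 'rV[R]_k -> 'rV[R]_l) (g : 'rV[R]_l -> R) x :
  differentiable f x -> differentiable g (f x) ->
  gradient (g \o f) x = 'J f x *m gradient g (f x).
Proof.
move=> df dg; apply/colP => i; rewrite mxE deriveE; last exact: differentiable_comp.
rewrite (diff_comp df dg) /= -(deriveE _ dg) -(mul_gradient _ dg) -(deriveE _ df).
by rewrite deriveEjacobian // -mulmxA -rowE mxE.
Qed.

End Jacobian.

Section Charts.
Context {R : realType} {m : nat} {M : closed_manifold R m}.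
Implicit Types (p q r x : M) (F G : M -> M) (f : M -> R) (a : form1 M).

Let open_dom p : open (dom p) := @dom_open _ _ M p.
Let open_img p : open (img p) := @img_open _ _ M p.

Lemma img_chart p x : dom p x -> img p (chart p x).
Proof. by move=> px; exists x. Qed.

Lemma dom_chart_inv p y : img p y -> dom p (chart_inv p y).
Proof. by move=> [x px <-]; rewrite chartK. Qed.

Lemma chart_invK p y : img p y -> chart p (chart_inv p y) = y.
Proof. by move=> [x px <-]; rewrite chartK. Qed.

Lemma chart_cvg p x : dom p x -> chart p z @[z --> x] --> chart p x.
Proof.
move=> px; have := @chart_continuous _ _ M p.
by rewrite continuous_open_subspace; [apply; rewrite inE|exact: open_dom].
Qed.

Lemma chart_inv_cvg p y :
  img p y -> chart_inv p z @[z --> y] --> chart_inv p y.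
Proof.
move=> py; have := @chart_inv_continuous _ _ M p.
by rewrite continuous_open_subspace; [apply; rewrite inE|exact: open_img].
Qed.

Lemma near_chart_inv p x (A : set M) : dom p x -> nbhs x A ->
  \forall y \near chart p x, img p y /\ A (chart_inv p y).
Proof.
move=> px xA; have H1 := open_near (@open_img p) (img_chart px).
have H2 : nbhs (chart p x) (chart_inv p @^-1` A).
  by apply: (chart_inv_cvg (img_chart px)); rewrite chartK.
exact: filterI H1 H2.
Qed.

Definition rep p q F : 'rV[R]_m -> 'rV[R]_m := chart q \o F \o chart_inv p.

Definition rep_dom p q F : set 'rV[R]_m :=
  [set y | img p y /\ dom q (F (chart_inv p y))].

Lemma open_pullback p (A : set M) : open A ->
  open [set y | img p y /\ A (chart_inv p y)].
Proof.
move=> oA; rewrite openE => y [py Ay]; have py' := dom_chart_inv py.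
rewrite -(chart_invK py); apply: near_chart_inv => //.
exact: open_near.
Qed.

Lemma rep_dom_open p q F : continuous F -> open (rep_dom p q F).
Proof.
move=> cF; apply: (@open_pullback p (F @^-1` dom q)).
by apply: open_comp => [x _|]; [exact: cF|exact: open_dom].
Qed.

Lemma rep_differentiable p q F x : smooth_map F -> dom p x -> dom q (F x) ->
  differentiable (rep p q F) (chart p x).
Proof.
move=> [cF sF] px qx; apply: smooth_on_differentiable (sF p q) _.
  exact: rep_dom_open.
by split; [exact: img_chart|rewrite chartK].
Qed.

Lemma rep_comp_near p q r F G x : continuous G -> dom p x -> dom r (G x) ->
  \forall y \near chart p x, rep p q (F \o G) y = (rep r q F \o rep p r G) y.
Proof.
move=> cG px rx.
have : nbhs x (G @^-1` dom r) by apply: cG; exact: open_near (@open_dom r) rx.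
move=> /(near_chart_inv px); apply: filterS => y [py ry].
by rewrite /rep /= chartK.
Qed.

Lemma smooth_map_id : smooth_map (@id M).
Proof.
split=> [x|p q]; first exact: cvg_id.
have sT := @transition_smooth _ _ M p q.
apply: sub_smooth_on sT => y [py qy]; exists (chart_inv p y).
  by split=> //; exact: dom_chart_inv.
exact: chart_invK.
Qed.

Lemma smooth_map_comp F G : smooth_map F -> smooth_map G -> smooth_map (F \o G).
Proof.
move=> [cF sF] [cG sG]; split=> [x|p q].
  by apply: continuous_comp; [exact: cG|exact: cF].
apply: smooth_on_local => y [py qy]; set x := chart_inv p y in qy *.
have px : dom p x by exact: dom_chart_inv.
pose r := G x; have rx : dom r (G x) by exact: mem_dom.
exists (rep_dom p r G `&` rep_dom p q (F \o G)), (rep r q F \o rep p r G); split.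
- apply: (smooth_on_comp (B := rep_dom r q F)).
  + by apply: sub_smooth_on (sG p r) => z [].
  + exact: sF.
  + move=> z [[pz rz] [_ qz]]; split; first exact: img_chart.
    by rewrite /= chartK.
- by [].
- have ryD : rep_dom p r G y by [].
  by apply: filterS (open_near (rep_dom_open cG) ryD) => z Dz [pz qz].
- by move=> z [pz qz] [[_ rz] _]; rewrite /rep /= chartK.
Qed.

(** The chain rule holds with any intermediate chart; all comparisons between
    preferred charts and a fixed chart are instances with [F] or [G] the
    identity. *)
Lemma rep_comp p q r F G x : smooth_map F -> smooth_map G ->
  dom p x -> dom r (G x) -> dom q (F (G x)) ->
  'J (rep p q (F \o G)) (chart p x) =
  'J (rep p r G) (chart p x) *m 'J (rep r q F) (chart r (G x)).
Proof.
move=> sF sG px rx qx.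
have E : rep p r G (chart p x) = chart r (G x) by rewrite /rep /= chartK.
have dFG : differentiable (rep p q (F \o G)) (chart p x).
  by apply: rep_differentiable => //; exact: smooth_map_comp.
rewrite [LHS](near_jacobian (rep_comp_near q F sG.1 px rx) dFG) -E.
apply: jacobian_comp; first exact: rep_differentiable.
by rewrite E; exact: rep_differentiable.
Qed.

Lemma tangent_map_comp F G x : smooth_map F -> smooth_map G ->
  tangent_map (F \o G) x = tangent_map G x *m tangent_map F (G x).
Proof. by move=> sF sG; apply: rep_comp => //; exact: mem_dom. Qed.

Lemma tangent_map_id x : tangent_map (@id M) x = 1%:M.
Proof.
have d : differentiable (rep x x id) (chart x x).
  by apply: rep_differentiable; [exact: smooth_map_id|exact: mem_dom..].
rewrite -(jacobian_id (chart x x)); apply: near_jacobian d.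
apply: filterS (open_near (@open_img x) (img_chart (mem_dom x))) => y xy.
exact: chart_invK.
Qed.

Lemma to_preferredE p y : to_preferred p y = 'J (rep p (chart_inv p y) id) y.
Proof. by []. Qed.

(** A primitive of a 1-form is in general available only on an open set, where
    it is one restriction of an otherwise arbitrary function on [M]. *)
Definition smooth_fun_on (U : set M) f : Prop :=
  forall p, smooth_on [set y | img p y /\ U (chart_inv p y)] (f \o chart_inv p).

Lemma smooth_funP f : smooth_fun f <-> smooth_fun_on setT f.
Proof.
have E p : [set y | img p y /\ [set: M] (chart_inv p y)] = img p.
  by apply/seteqP; split=> [y []|y].
by split=> sf p; have := sf p; rewrite /smooth_fun_on E.
Qed.

Lemma sub_smooth_fun_on (U V : set M) f :
  U `<=` V -> smooth_fun_on V f -> smooth_fun_on U f.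
Proof.
by move=> UV sf p; apply: sub_smooth_on (sf p) => y [py /UV].
Qed.

Lemma smooth_fun_local f :
  (forall x, exists U g, [/\ open U, U x, smooth_fun_on U g &
     forall y, U y -> f y = g y]) -> smooth_fun f.
Proof.
move=> H p; apply: smooth_on_local => y py.
have [U [g [oU Ux sg fg]]] := H (chart_inv p y).
exists [set y | img p y /\ U (chart_inv p y)], (g \o chart_inv p); split=> //.
  by apply: (filterS _ (@open_near _ _ y (@open_pullback p U oU) (conj py Ux))).
by move=> z pz [_ Uz] /=; rewrite fg.
Qed.

Lemma smooth_fun_on_differentiable (U : set M) f p x : open U ->
  smooth_fun_on U f -> U x -> dom p x -> differentiable (f \o chart_inv p) (chart p x).
Proof.
move=> oU sf Ux px; apply: smooth_on_differentiable (sf p) _.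
  exact: open_pullback.
by split; [exact: img_chart|rewrite chartK].
Qed.

Lemma smooth_fun_on_comp (U : set M) f G : smooth_map G -> smooth_fun_on U f ->
  smooth_fun_on (G @^-1` U) (f \o G).
Proof.
move=> [cG sG] sf p; apply: smooth_on_local => y [py Uy].
pose r := G (chart_inv p y); have rx : dom r r by exact: mem_dom.
exists (rep_dom p r G `&` [set y | img p y /\ U (G (chart_inv p y))]).
exists ((f \o chart_inv r) \o rep p r G); split.
- apply: (smooth_on_comp (B := [set y | img r y /\ U (chart_inv r y)])).
  + by apply: sub_smooth_on (sG p r) => z [].
  + exact: sf.
  + move=> z [[pz rz] [_ Uz]]; split; first exact: img_chart.
    by rewrite /rep /= chartK.
- by [].
- have ryD : rep_dom p r G y by [].
  by apply: filterS (open_near (rep_dom_open cG) ryD) => z Dz [pz qz].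
- by move=> z [pz qz] [[_ rz] _]; rewrite /rep /= chartK.
Qed.

Lemma smooth_fun_onD (U : set M) f g : smooth_fun_on U f -> smooth_fun_on U g ->
  smooth_fun_on U (fun x => f x + g x).
Proof. by move=> sf sg p; exact: smooth_on_add (sf p) (sg p). Qed.

Lemma smooth_fun_onN (U : set M) f : smooth_fun_on U f ->
  smooth_fun_on U (fun x => - f x).
Proof. by move=> sf p; exact: smooth_on_opp (sf p). Qed.

Lemma dfunE f x : dfun f x = gradient (f \o chart_inv x) (chart x x).
Proof. by []. Qed.

Lemma gradient_near (f g : 'rV[R]_m -> R) (x : 'rV[R]_m) :
  (\forall y \near x, f y = g y) -> gradient f x = gradient g x.
Proof. by move=> fg; apply/colP => i; rewrite !mxE (near_eq_derive _ fg). Qed.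

Lemma dfun_near f g x : (\forall y \near x, f y = g y) -> dfun f x = dfun g x.
Proof.
move=> fg; apply: gradient_near.
have : nbhs x [set y | f y = g y] by exact: fg.
by move=> /(near_chart_inv (mem_dom x)); apply: filterS => y [].
Qed.

(** Freedom in [q] lets a primitive found in one chart be differentiated at the
    neighbouring points, whose preferred charts differ from it. *)
Lemma dfun_comp_chart (h : 'rV[R]_m -> R) q G x : smooth_map G -> dom q (G x) ->
  differentiable h (chart q (G x)) ->
  dfun (h \o chart q \o G) x =
  'J (rep x q G) (chart x x) *m gradient h (chart q (G x)).
Proof.
move=> sG qx dh; rewrite dfunE.
have E : rep x q G (chart x x) = chart q (G x) by rewrite /rep /= chartK //; exact: mem_dom.
have -> : (h \o chart q \o G) \o chart_inv x = h \o rep x q G by [].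
rewrite gradient_comp ?E //; apply: rep_differentiable => //; exact: mem_dom.
Qed.

Lemma dfun_comp (U : set M) f G x : smooth_map G -> open U ->
  smooth_fun_on U f -> U (G x) ->
  dfun (f \o G) x = tangent_map G x *m dfun f (G x).
Proof.
move=> sG oU sf Ux; have qx := mem_dom (G x).
rewrite [in RHS]dfunE -dfun_comp_chart //; last exact: smooth_fun_on_differentiable sf Ux qx.
apply: dfun_near.
have : nbhs x (G @^-1` dom (G x)) by apply: sG.1; exact: open_near (@open_dom _) qx.
by apply: filterS => y yq; rewrite /= chartK.
Qed.

Lemma dfunD (U : set M) f g x : open U -> U x -> smooth_fun_on U f ->
  smooth_fun_on U g -> dfun (fun y => f y + g y) x = dfun f x + dfun g x.
Proof.
move=> oU Ux sf sg; apply/colP => i; rewrite !mxE.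
have df := smooth_fun_on_differentiable oU sf Ux (mem_dom x).
have dg := smooth_fun_on_differentiable oU sg Ux (mem_dom x).
exact: deriveD (diff_derivable df) (diff_derivable dg).
Qed.

Lemma dfunN (U : set M) f x : open U -> U x -> smooth_fun_on U f ->
  dfun (fun y => - f y) x = - dfun f x.
Proof.
move=> oU Ux sf; apply/colP => i; rewrite !mxE.
have df := smooth_fun_on_differentiable oU sf Ux (mem_dom x).
exact: deriveN (diff_derivable df).
Qed.

Lemma B1D a b : @B1 R m M a -> @B1 R m M b -> @B1 R m M (fun x => a x + b x).
Proof.
move=> [f /smooth_funP sf <-] [g /smooth_funP sg <-].
exists (fun x => f x + g x); first exact/smooth_funP/smooth_fun_onD.
by apply/funext => x; rewrite (dfunD openT I sf sg).
Qed.

Lemma B1N a : @B1 R m M a -> @B1 R m M (fun x => - a x).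
Proof.
move=> [f /smooth_funP sf <-].
exists (fun x => - f x); first exact/smooth_funP/smooth_fun_onN.
by apply/funext => x; rewrite (dfunN openT I sf).
Qed.

End Charts.

(** * Velocities of families of maps *)

Section WithinDerivative.
Context {R : realType}.

Definition within_unit_dnbhs (t : R) := within `[0, 1]%classic (t^').

#[global] Instance within_unit_dnbhs_filter (t : R) :
  Filter (within_unit_dnbhs t).
Proof. by rewrite /within_unit_dnbhs; exact: _. Qed.

Lemma within_unit_dnbhs_proper (t : R) : `[0, 1]%classic t ->
  ProperFilter (within_unit_dnbhs t).
Proof.
rewrite /= in_itv /= => /andP[t0 t1]; apply: Build_ProperFilter_ex => A.
move=> /nbhs_ballP[e /= e0 He].
have [tl|tg] := ltP t 1.
  pose d := Num.min e (1 - t) / 2.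
  have d0 : 0 < d by rewrite divr_gt0 // lt_min e0 subr_gt0.
  have [de dt] : d < e /\ d < 1 - t.
    have de : d < Num.min e (1 - t).
      by rewrite ltr_pdivrMr // ltr_pMr ?ltr1n // lt_min e0 subr_gt0.
    by move: de; rewrite lt_min => /andP.
  exists (t + d); apply: He.
  - by rewrite -ball_normE /= opprD addrA subrr add0r normrN gtr0_norm.
  - by rewrite eq_sym lt_eqF // ltrDl.
  - rewrite /= in_itv /= addr_ge0 ?(ltW d0) //=.
    by rewrite -lerBrDl; exact: ltW.
pose d := Num.min e 1 / 2.
have d0 : 0 < d by rewrite divr_gt0 // lt_min e0 ltr01.
have [de d1] : d < e /\ d < 1.
  have de : d < Num.min e 1.
    by rewrite ltr_pdivrMr // ltr_pMr ?ltr1n // lt_min e0 ltr01.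
  by move: de; rewrite lt_min => /andP.
have tE : t = 1 by apply/eqP; rewrite eq_le t1 tg.
exists (t - d); apply: He.
- by rewrite -ball_normE /= opprB addrC addrNK gtr0_norm.
- by rewrite lt_eqF // ltrBlDr ltrDl.
- by rewrite /= in_itv /= tE subr_ge0 (ltW d1) /= lerBlDr lerDl ltW.
Qed.

Lemma near_within_unit (t : R) (P : R -> Prop) :
  (\forall s \near t, `[0, 1]%classic s -> P s) ->
  \forall s \near within_unit_dnbhs t, P s.
Proof. by move=> nP; apply: filterS nP => s Ps _. Qed.

Lemma within_unit_cvg (t : R) : s @[s --> within_unit_dnbhs t] --> t.
Proof. by move=> A tA; apply: near_within_unit; apply: filterS tA. Qed.

Lemma within_unit_neq (t : R) : \forall s \near within_unit_dnbhs t, s - t != 0.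
Proof.
by apply/nbhs_ballP; exists 1 => //= s _ st _; rewrite subr_eq0.
Qed.

(** The difference quotient is restricted to [0,1] so that it is one-sided at
    the ends, where a path says nothing about later or earlier times. *)
Definition is_wderive (V : normedModType R) (u : R -> V) (t : R) (d : V) :=
  (s - t)^-1 *: (u s - u t) @[s --> within_unit_dnbhs t] --> d.

Lemma is_wderive_unique (V : normedModType R) (u : R -> V) (t : R) (d d' : V) :
  `[0, 1]%classic t -> is_wderive u t d -> is_wderive u t d' -> d = d'.
Proof.
move=> t01 ud ud'; have FF := within_unit_dnbhs_proper t01.
exact: (cvg_unique _ ud ud').
Qed.

Lemma is_derive_wderive (V : normedModType R) (u : R -> V) (t : R) (d : V) :
  is_derive t 1 u d -> is_wderive u t d.
Proof.
move=> [du <-].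
have cu : h^-1 *: ((u \o shift t) (h *: (1 : R)) - u t) @[h --> (0 : R)^'] --> 'D_1 u t.
  exact: du.
apply/cvgrPdist_le => e e0.
have cue : \forall h \near (0 : R)^',
    `|'D_1 u t - h^-1 *: ((u \o shift t) (h *: (1 : R)) - u t)| <= e.
  exact: (cvgrPdist_le _ _).1 cu e e0.
move: cue => /nbhs_ballP[d0 /= d00 H].
apply/nbhs_ballP; exists d0 => //= s st sn _.
have h1 : (s - t) *: (1 : R^o) = s - t by rewrite /GRing.scale /= mulr1.
have := H (s - t); rewrite /= [_ *: 1]h1 subrK; apply; last by rewrite subr_eq0.
by rewrite -ball_normE /= sub0r opprB; move: st; rewrite -ball_normE.
Qed.

Lemma is_wderive_cvg (V : normedModType R) (u : R -> V) (t : R) (d : V) :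
  is_wderive u t d -> u s @[s --> within_unit_dnbhs t] --> u t.
Proof.
move=> ud.
have c0 : (s - t) @[s --> within_unit_dnbhs t] --> (0 : R).
  have c1 : (fun=> t) @ within_unit_dnbhs t --> t by exact: cvg_cst.
  by have := cvgB (@within_unit_cvg t) c1; rewrite subrr; apply.
have c2 : (fun _ : R => u t) s @[s --> within_unit_dnbhs t] --> u t by move=> A; exact: cvg_cst.
have c3 : (s - t) *: ((s - t)^-1 *: (u s - u t)) + u t
    @[s --> within_unit_dnbhs t] --> 0 *: d + u t.
  by apply: cvgD c2; apply: cvgZ c0 ud.
rewrite scale0r add0r in c3; apply: cvg_trans c3; apply: near_eq_cvg.
apply: filterS (within_unit_neq t) => s st.
by rewrite scalerA mulfV // scale1r addrNK.
Qed.

Lemma near_is_wderive (V : normedModType R) (u u' : R -> V) (t : R) (d : V) :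
  u t = u' t -> (\forall s \near within_unit_dnbhs t, u s = u' s) ->
  is_wderive u t d -> is_wderive u' t d.
Proof.
move=> ut uu'; apply: cvg_trans; apply: near_eq_cvg.
by apply: filterS uu' => s ->; rewrite ut.
Qed.

Lemma is_wderive_comp (V W : normedModType R) (u : R -> V) (K : V -> W) (t : R) d :
  is_wderive u t d -> differentiable K (u t) ->
  is_wderive (K \o u) t ('D_d K (u t)).
Proof.
move=> ud dK.
have bnd : \forall s \near within_unit_dnbhs t,
    `|(s - t)^-1 *: (u s - u t)| <= `|d| + 1.
  have n0 : \forall s \near within_unit_dnbhs t,
      `|d - (s - t)^-1 *: (u s - u t)| <= 1 by exact: (cvgrPdist_le _ _).1 ud 1 ltr01.
  apply: filterS n0 => s H.
  rewrite -lerBlDl; apply: le_trans H; rewrite distrC; exact: lerB_dist.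
have dKc : continuous ('d K (u t)) := diff_continuous dK.
have c1 : 'd K (u t) ((s - t)^-1 *: (u s - u t)) @[s --> within_unit_dnbhs t]
    --> 'd K (u t) d.
  exact: (cvg_comp _ _ ud (dKc d)).
apply/cvgrPdist_le => e e0; rewrite deriveE //.
have e2 : 0 < e / 2 by rewrite divr_gt0.
have d1 : 0 < `|d| + 1 by rewrite ltr_wpDl.
have e3 : 0 < e / 2 / (`|d| + 1) by rewrite divr_gt0.
have n1 : \forall s \near within_unit_dnbhs t,
    `|'d K (u t) d - 'd K (u t) ((s - t)^-1 *: (u s - u t))| <= e / 2.
  exact: (cvgrPdist_le _ _).1 c1 _ e2.
have n2 : \forall s \near within_unit_dnbhs t,
    `|K (u s) - K (u t) - 'd K (u t) (u s - u t)| <=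
    e / 2 / (`|d| + 1) * `|u s - u t|.
  exact: is_wderive_cvg ud _ (differentiable_dist dK e3).
apply: filterS (filterI (filterI n1 n2) bnd) => s [[H1 H2] H3].
rewrite /= in H1 H2 *.
have E : (s - t)^-1 *: (K (u s) - K (u t)) =
    'd K (u t) ((s - t)^-1 *: (u s - u t)) +
    (s - t)^-1 *: (K (u s) - K (u t) - 'd K (u t) (u s - u t)).
  by rewrite linearZ /= -scalerDr [X in _ = _ *: X]addrC addrNK.
rewrite E opprD addrA (splitr e); apply: le_trans (ler_normB _ _) _.
apply: lerD => //; rewrite normrZ.
apply: le_trans (ler_wpM2l (normr_ge0 _) H2) _.
rewrite mulrCA -normrZ -[leRHS](divfK (lt0r_neq0 d1)).
by rewrite ler_pM2l.
Qed.

End WithinDerivative.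

Lemma line_cvg (R : realType) (V : normedModType R) (x v : V) (t : R) :
  (x + s *: v) @[s --> t] --> x + t *: v.
Proof.
have c0 : (fun _ : R => x) s @[s --> t] --> x by move=> A; exact: cvg_cst.
have c1 : s @[s --> t] --> (t : R) by exact: cvg_id.
exact: cvgD c0 (cvgZr_tmp c1).
Qed.

Section TimePoint.
Context {R : realType}.

Lemma smooth_on_id k (A : set 'rV[R]_k) : smooth_on A (fun x : 'rV[R]_k => x).
Proof.
move=> x Ax; exists setT, id; split=> //; first exact: openT.
apply: (smooth_open_primitive (h := fun v _ => v)) => //.
- exact: openT.
- move=> v; apply/(smooth_on_open _ openT); exact: smooth_on_cst.
- by move=> v y _; exact: derive_id.
Qed.

Definition time_point m (t : R) (y : 'rV[R]_m) : 'rV[R]_(1 + m) :=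
  row_mx (t%:M : 'M[R]_1) y.

Lemma time_point_l m (t : R) (y : 'rV[R]_m) : lsubmx (time_point t y) 0 0 = t.
Proof. by rewrite row_mxKl mxE eqxx. Qed.

Lemma time_point_r m (t : R) (y : 'rV[R]_m) : rsubmx (time_point t y) = y.
Proof. exact: row_mxKr. Qed.

Lemma time_pointD m (s t : R) (y v : 'rV[R]_m) :
  time_point s y + time_point t v = time_point (s + t) (y + v).
Proof. by rewrite /time_point add_row_mx -raddfD. Qed.

Lemma time_pointB m (s t : R) (y v : 'rV[R]_m) :
  time_point s y - time_point t v = time_point (s - t) (y - v).
Proof. by rewrite /time_point opp_row_mx add_row_mx -raddfB. Qed.

Lemma time_pointZ m (s t : R) (y : 'rV[R]_m) :
  s *: time_point t y = time_point (s * t) (s *: y).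
Proof. by rewrite /time_point scale_row_mx scale_scalar_mx. Qed.

Lemma lsubmx_mul m (z : 'rV[R]_(1 + m)) : lsubmx z = z *m col_mx 1%:M 0.
Proof. by rewrite -{2}[z]hsubmxK mul_row_col mulmx1 mulmx0 addr0. Qed.

Lemma rsubmx_mul m (z : 'rV[R]_(1 + m)) : rsubmx z = z *m col_mx 0 1%:M.
Proof. by rewrite -{2}[z]hsubmxK mul_row_col mulmx1 mulmx0 add0r. Qed.

Lemma smooth_on_rsubmx m (A : set 'rV[R]_(1 + m)) : smooth_on A rsubmx.
Proof.
apply: (@eq_smooth_on _ _ _ _ (fun z => z *m col_mx 0 1%:M)).
  by move=> z _; rewrite rsubmx_mul.
by apply: smooth_on_mulmx; [exact: smooth_on_id|exact: smooth_on_cst].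
Qed.

Lemma smooth_on_time_point m k (A : set 'rV[R]_(1 + m)) (g : 'rV[R]_(1 + m) -> 'rV[R]_k) :
  smooth_on A g -> smooth_on A (fun z => time_point (lsubmx z 0 0) (g z)).
Proof.
move=> sg; apply: (@eq_smooth_on _ _ _ _
   (fun z => z *m col_mx 1%:M 0 *m row_mx 1%:M 0 + g z *m row_mx 0 1%:M)).
  move=> z _; rewrite -lsubmx_mul !mul_mx_row !mulmx1 !mulmx0 add_row_mx addr0 add0r.
  by rewrite /time_point -mx11_scalar.
apply: smooth_on_add; last by apply: smooth_on_mulmx => //; exact: smooth_on_cst.
apply: smooth_on_mulmx; last exact: smooth_on_cst.
by apply: smooth_on_mulmx; [exact: smooth_on_id|exact: smooth_on_cst].
Qed.

Lemma smooth_on_slice m (A : set 'rV[R]_m) (t : R) : smooth_on A (time_point t).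
Proof.
apply: (@eq_smooth_on _ _ _ _ (fun y => row_mx t%:M 0 + y *m row_mx 0 1%:M)).
  by move=> y _; rewrite mul_mx_row mulmx1 mulmx0 add_row_mx addr0 add0r.
apply: smooth_on_add; first exact: smooth_on_cst.
by apply: smooth_on_mulmx; [exact: smooth_on_id|exact: smooth_on_cst].
Qed.

Lemma time_cvg m (z : 'rV[R]_(1 + m)) : lsubmx x 0 0 @[x --> z] --> (lsubmx z 0 0 : R).
Proof.
have c1 : lsubmx x @[x --> z] --> (lsubmx z : 'M[R]_1) by exact: continuous_lsubmx.
exact: cvg_comp c1 (@coord_continuous _ _ _ 0 0 (lsubmx z)).
Qed.

Lemma space_cvg m (z : 'rV[R]_(1 + m)) : rsubmx x @[x --> z] --> (rsubmx z : 'rV[R]_m).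
Proof. exact: continuous_rsubmx. Qed.

Lemma time_point_line m (s : R) (y : 'rV[R]_m) :
  time_point s y = time_point 0 y + s *: time_point 1 0.
Proof. by rewrite time_pointZ time_pointD mulr1 add0r scaler0 addr0. Qed.

Lemma near_time_point k (O : set 'rV[R]_(1 + k)) (t : R) y : open O ->
  O (time_point t y) -> \forall s \near t, O (time_point s y).
Proof.
move=> oO Ot.
have nO : nbhs (time_point 0 y + t *: time_point 1 0) O.
  by rewrite -time_point_line; exact: open_near oO Ot.
have nO' : \forall s \near t, O (time_point 0 y + s *: time_point 1 0).
  exact: line_cvg nO.
by apply: filterS nO' => s; rewrite -time_point_line.
Qed.

Lemma slice_cvg k (s : R) (y : 'rV[R]_k) :
  time_point s x @[x --> y] --> time_point s y.
Proof.
apply: differentiable_continuous.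
exact: smooth_on_differentiable openT (@smooth_on_slice _ _ s) I.
Qed.

Lemma derive_slice k (W : normedModType R) (K : 'rV[R]_(1 + k) -> W) (s : R)
    (y : 'rV[R]_k) :
  differentiable K (time_point s y) ->
  differentiable (K \o time_point s) y /\
  forall v, 'D_v (K \o time_point s) y = 'D_(time_point 0 v) K (time_point s y).
Proof.
move=> dK.
have ds : differentiable (time_point s) y.
  exact: smooth_on_differentiable openT (@smooth_on_slice _ _ s) I.
split=> [|v]; first exact: differentiable_comp.
have Dv : 'D_v (time_point s) y = time_point 0 v.
  apply: derive_val; apply: line_derive.
  have -> : (fun h : R => time_point s (y + h *: v)) =
      (fun h : R => id (time_point s y + h *: time_point 0 v)).
    by apply/funext => h; rewrite time_pointZ mulr0 time_pointD addr0.
  rewrite -[X in is_derive _ _ _ X](derive_id (time_point s y + (0 : R) *: time_point 0 v)).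
  by apply: derive_line; exact: derivable_id.
have dKs := differentiable_comp ds dK.
by rewrite [LHS](deriveE v dKs) (diff_comp ds dK) /= -(deriveE v ds) Dv -(deriveE _ dK).
Qed.

End TimePoint.

Section Families.
Context {R : realType} {m : nat} {M : closed_manifold R m}.
Implicit Types (p q r x : M) (F G : R -> M -> M).
Local Notation unitI := (`[0, 1]%classic : set R).

Lemma family_cvg F (t : R) x (A : set M) : smooth_family F -> unitI t ->
  nbhs (F t x) A -> \forall z \near (t, x), unitI z.1 -> A (F z.1 z.2).
Proof.
move=> [cF _] t01 nA.
have H : nbhs (t, x) (fun z : R * M =>
    (unitI `*` [set: M]) z -> A (F z.1 z.2)).
  exact: (subspace_continuousP _ _).1 cF (t, x) (conj t01 I) A nA.
by apply: filterS H => z H z01; exact: H.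
Qed.

Definition chart_point p (z : 'rV[R]_(1 + m)) : R * M :=
  (lsubmx z 0 0, chart_inv p (rsubmx z)).

Lemma chart_point_cvg p (z : 'rV[R]_(1 + m)) : img p (rsubmx z) ->
  chart_point p z' @[z' --> z] --> chart_point p z.
Proof.
move=> pz.
have c2 : chart_inv p (rsubmx z') @[z' --> z] --> chart_inv p (rsubmx z).
  exact: (cvg_comp _ _ (@space_cvg _ _ z) (chart_inv_cvg pz)).
exact: cvg_pair (@time_cvg _ _ z) c2.
Qed.

Lemma family_chart_near F p (z : 'rV[R]_(1 + m)) (A : set M) : smooth_family F ->
  unitI (lsubmx z 0 0) -> img p (rsubmx z) ->
  nbhs (F (lsubmx z 0 0) (chart_inv p (rsubmx z))) A ->
  \forall z' \near z, unitI (lsubmx z' 0 0) ->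
    A (F (lsubmx z' 0 0) (chart_inv p (rsubmx z'))).
Proof.
move=> sF z01 pz nA; exact: (chart_point_cvg pz) (family_cvg sF z01 nA).
Qed.

Lemma family_comp F G : smooth_family F -> smooth_family G ->
  smooth_family (fun t x => F t (G t x)).
Proof.
move=> sF sG; split.
  apply/subspace_continuousP => -[t x] [t01 _] A /= nA.
  have [[B1 B2] /= [tB1 B2x] B12] := family_cvg sF t01 nA.
  have H1 : \forall z \near (t, x), B1 z.1 by exact: (@cvg_fst _ _ (nbhs t) (nbhs x)).
  apply: filterS (filterI H1 (family_cvg sG t01 B2x)) => z [Bz H] [z01 _].
  by apply: (B12 (z.1, G z.1 z.2)) => //; split=> //; exact: H.
move=> p q /=.
apply: smooth_on_local => z [z01 pz qz].
set t := lsubmx z 0 0 in z01 qz *; set x := chart_inv p (rsubmx z) in qz *.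
pose r := G t x; have rr : dom r (G t x) := mem_dom r.
pose B := [set z' : 'rV[R]_(1 + m) | [/\ unitI (lsubmx z' 0 0), img p (rsubmx z'),
  dom r (G (lsubmx z' 0 0) (chart_inv p (rsubmx z'))) &
  dom q (F (lsubmx z' 0 0) (G (lsubmx z' 0 0) (chart_inv p (rsubmx z'))))]].
pose f (z' : 'rV[R]_(1 + m)) := chart q (F (lsubmx z' 0 0) (chart_inv r (rsubmx z'))).
pose g (z' : 'rV[R]_(1 + m)) := time_point (lsubmx z' 0 0)
  (chart r (G (lsubmx z' 0 0) (chart_inv p (rsubmx z')))).
exists B, (f \o g); split.
- apply: smooth_on_comp (sF.2 r q) _.
    apply: smooth_on_time_point; apply: sub_smooth_on (sG.2 p r).
    by move=> z' [].
  move=> z' [z01' pz' rz' qz']; rewrite /g /= time_point_l time_point_r chartK //.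
  by split=> //; exact: img_chart.
- by [].
- have nr := open_near (@dom_open _ _ M r) rr.
  apply: filterS (family_chart_near sG z01 pz nr) => z' H [z01' pz' qz'].
  by split=> //; exact: H.
- move=> z' [z01' pz' qz'] [_ _ rz' _].
  by rewrite /f /g /= time_point_l time_point_r chartK.
Qed.

Lemma family_id : smooth_family (fun _ => @id M).
Proof.
split.
  apply/subspace_continuousP => -[t x] _; apply: cvg_within_filter; exact: cvg_snd.
move=> p q /=.
have [_ sid] := @smooth_map_id _ _ M.
apply: (smooth_on_comp (@smooth_on_rsubmx _ _ _) (sid p q)).
by move=> z [].
Qed.

(** Near each of its points the chart expression of a family is the restriction
    of a smooth function of time and space, defined also for times outside
    [0,1]; calculus is done on that extension. *)
Lemma family_ext F p q (t : R) x : smooth_family F -> unitI t ->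
  dom p x -> dom q (F t x) ->
  exists (O : set 'rV[R]_(1 + m)) (G : 'rV[R]_(1 + m) -> 'rV[R]_m),
    [/\ open O, O (time_point t (chart p x)), smooth_open O G &
    forall s y, unitI s -> O (time_point s y) ->
      [/\ img p y, dom q (F s (chart_inv p y)) &
          chart q (F s (chart_inv p y)) = G (time_point s y)]].
Proof.
move=> sF t01 px qx.
pose z := time_point t (chart p x).
have zl : lsubmx z 0 0 = t := time_point_l _ _.
have zr : rsubmx z = chart p x := time_point_r _ _.
have Sz : [/\ unitI (lsubmx z 0 0), img p (rsubmx z) &
    dom q (F (lsubmx z 0 0) (chart_inv p (rsubmx z)))].
  by rewrite zl zr chartK //; split=> //; exact: img_chart.
have [U [G [oU Uz sG FG]]] := sF.2 p q z Sz.
have [z01 pz qz] := Sz.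
have nq := open_near (@dom_open _ _ M q) qz.
have n1 := family_chart_near sF z01 pz nq.
have n2 : \forall z' \near z, img p (rsubmx z').
  exact: (@space_cvg _ _ z) (open_near (@img_open _ _ M p) pz).
have : nbhs z [set z' | (unitI (lsubmx z' 0 0) -> 
   dom q (F (lsubmx z' 0 0) (chart_inv p (rsubmx z')))) /\ img p (rsubmx z')].
  exact: filterI n1 n2.
rewrite nbhsE => -[V [oV Vz] HV].
exists (U `&` V), G; split.
- exact: openI.
- by [].
- by apply: sub_smooth_open sG => z' [].
- move=> s y s01 [Us Vs]; have [H1 H2] := HV _ Vs.
  rewrite time_point_l time_point_r in H1; rewrite time_point_r in H2.
  have H3 := H1 s01; split=> //.
  rewrite -FG // /mkset; rewrite time_point_l time_point_r //.
Qed.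

End Families.

Section Velocity.
Context {R : realType} {m : nat} {M : closed_manifold R m}.
Implicit Types (p q r x : M) (F G : R -> M -> M).
Local Notation unitI := (`[0, 1]%classic : set R).

Definition is_vel q F (t : R) x (d : 'rV[R]_m) : Prop :=
  is_wderive (fun s => chart q (F s x)) t d.

Lemma curve_near F (t : R) x (A : set M) : smooth_family F -> unitI t ->
  nbhs (F t x) A -> \forall s \near within_unit_dnbhs t, A (F s x).
Proof.
move=> sF t01 nA; apply: near_within_unit.
have [[B1 B2] /= [tB1 xB2] B12] := family_cvg sF t01 nA.
apply: filterS tB1 => s Bs s01.
by apply: (B12 (s, x)) => //; split=> //; exact: nbhs_singleton.
Qed.

Lemma vel_ext F p q (t : R) x (O : set 'rV[R]_(1 + m))
    (G : 'rV[R]_(1 + m) -> 'rV[R]_m) : smooth_family F -> unitI t ->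
  open O -> O (time_point t (chart p x)) -> smooth_open O G -> dom p x ->
  (forall s y, unitI s -> O (time_point s y) ->
      [/\ img p y, dom q (F s (chart_inv p y)) &
          chart q (F s (chart_inv p y)) = G (time_point s y)]) ->
  is_vel q F t x ('D_(time_point 1 0) G (time_point t (chart p x))).
Proof.
move=> sF t01 oO Oz sG px FG.
pose u (s : R) := G (time_point s (chart p x)).
have du : is_derive t 1 u ('D_(time_point 1 0) G (time_point t (chart p x))).
  have -> : u = (fun s : R => G (time_point 0 (chart p x) + s *: time_point 1 0)).
    by apply/funext => s; rewrite -time_point_line.
  rewrite [time_point t _]time_point_line; apply: derive_line.
  apply: diff_derivable; rewrite -time_point_line.
  exact: smooth_open_differentiable sG Oz.
have cO := near_time_point oO Oz.
have E s : unitI s -> O (time_point s (chart p x)) -> u s = chart q (F s x).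
  by move=> s01 Os; have [_ _] := FG _ _ s01 Os; rewrite chartK.
apply: (near_is_wderive (u := u)).
- exact: E.
- by apply: near_within_unit; apply: filterS cO => s Os s01; exact: E.
- exact: is_derive_wderive.
Qed.

Lemma vel_exists F q (t : R) x : smooth_family F -> unitI t -> dom q (F t x) ->
  exists d, is_vel q F t x d.
Proof.
move=> sF t01 qx; have px := mem_dom x.
have [ O [G [oO Oz sG FG]]] := family_ext sF t01 px qx.
by exists ('D_(time_point 1 0) G (time_point t (chart x x))); exact: (vel_ext sF t01 oO).
Qed.

Lemma is_wderive_time_point (u : R -> 'rV[R]_m) (t : R) d :
  is_wderive u t d -> is_wderive (fun s => time_point s (u s)) t (time_point 1 d).
Proof.
move=> ud.
have c1 : time_point 1 ((s - t)^-1 *: (u s - u t)) @[s --> within_unit_dnbhs t] -->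
    time_point 1 d.
  pose L (y : 'rV[R]_m) := time_point 1 0 + y *m row_mx 0 1%:M.
  have LE y : time_point 1 y = L y.
    by rewrite /L mul_mx_row mulmx0 mulmx1 add_row_mx addr0 add0r.
  have -> : time_point 1 = L by apply/funext => y; rewrite LE.
  have cL : {for d, continuous L}.
    apply: differentiable_continuous.
    apply: smooth_on_differentiable openT _ I.
    apply: smooth_on_add; first exact: smooth_on_cst.
    by apply: smooth_on_mulmx; [exact: smooth_on_id|exact: smooth_on_cst].
  exact: (cvg_comp _ _ ud cL).
apply: cvg_trans c1; apply: near_eq_cvg.
apply: filterS (within_unit_neq t) => s st.
by rewrite time_pointB time_pointZ mulVf.
Qed.

(** The chain rule for [s |-> F s (G s x)]: extend [F] in charts to a function of
    time and space and differentiate it along the curve [(s, G s x)]. *)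
Lemma vel_comp F G q r (t : R) x d e : smooth_family F -> smooth_family G ->
  smooth_map (F t) -> unitI t -> dom r (G t x) -> dom q (F t (G t x)) ->
  is_vel r G t x d -> is_vel q F t (G t x) e ->
  is_vel q (fun s y => F s (G s y)) t x
    (e + d *m 'J (rep r q (F t)) (chart r (G t x))).
Proof.
move=> sF sG sFt t01 rx qx Gd Fe; set y := G t x in rx qx Fe *.
have [ O [K [oO Oz sK FK]]] := family_ext sF t01 rx qx.
set z := time_point t (chart r y) in Oz.
have dK : differentiable K z := smooth_open_differentiable sK Oz.
have eE : e = 'D_(time_point 1 0) K z.
  apply: (is_wderive_unique t01 Fe); exact: (vel_ext sF t01 oO).
have dE : d *m 'J (rep r q (F t)) (chart r y) = 'D_(time_point 0 d) K z.
  have [dKt DKt] := derive_slice dK.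
  rewrite -deriveEjacobian; last exact: rep_differentiable.
  apply: etrans (DKt d); apply: near_eq_derive.
  have nO : \forall y' \near chart r y, O (time_point t y').
    exact: slice_cvg (open_near oO Oz).
  by apply: filterS nO => y' Oy'; have [_ _] := FK _ _ t01 Oy'.
have c1 := is_wderive_comp (is_wderive_time_point Gd) dK.
have -> : e + d *m 'J (rep r q (F t)) (chart r y) = 'D_(time_point 1 d) K z.
  rewrite eE dE !deriveE // -linearD /= time_pointD.
  by rewrite addr0 add0r.
have nr := curve_near sG t01 (open_near (@dom_open _ _ M r) rx).
have nO : \forall s \near within_unit_dnbhs t, O (time_point s (chart r (G s x))).
  exact: (is_wderive_cvg (is_wderive_time_point Gd)) (open_near oO Oz).
have n01 : \forall s \near within_unit_dnbhs t, unitI s by exact: near_within_unit (filterS (fun s _ => id) filterT).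
apply: near_is_wderive c1.
- by have [_ _] := FK _ _ t01 Oz; rewrite /= chartK.
- apply: filterS (filterI n01 (filterI nr nO)) => s [s01 [rs Os]] /=.
  by have [_ _] := FK _ _ s01 Os; rewrite chartK.
Qed.

Lemma vel_id q (t : R) x : is_vel q (fun _ => @id M) t x 0.
Proof.
rewrite /is_vel /is_wderive.
under eq_fun => s do rewrite subrr scaler0.
exact: cvg_cst.
Qed.

(** Changing charts is composing with the constant family of identities. *)
Lemma vel_chart F q r (t : R) x d : smooth_family F -> unitI t ->
  dom r (F t x) -> dom q (F t x) -> is_vel r F t x d ->
  is_vel q F t x (d *m 'J (rep r q id) (chart r (F t x))).
Proof.
move=> sF t01 rx qx Fd.
have H := vel_comp (@family_id _ _ M) sF (@smooth_map_id _ _ M) t01 rx qx Fd (vel_id _ _ _).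
by rewrite add0r in H.
Qed.

Lemma velocityE (Psi : R -> self_bij M) (t : R) x d : unitI t ->
  is_vel (Psi t x) (fun s => Psi s) t x d -> velocity Psi t x = d.
Proof.
move=> t01 Pd; have FF := within_unit_dnbhs_proper t01.
exact: (cvg_lim _ Pd).
Qed.

Lemma is_vel_velocity (Psi : R -> self_bij M) (t : R) x : unitI t ->
  smooth_family (fun s => Psi s) -> is_vel (Psi t x) (fun s => Psi s) t x (velocity Psi t x).
Proof.
move=> t01 sP; have [d Pd] := vel_exists sP t01 (mem_dom (Psi t x)).
by rewrite (velocityE t01 Pd).
Qed.

End Velocity.

(** * Paths of symplectomorphisms *)

Section SympPaths.
Context {R : realType} {m : nat} {M : closed_manifold R m}.
Variable w : form2 M.
Implicit Types (phi psi : self_bij M) (Psi Phi : R -> self_bij M) (a : form1 M).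
Local Notation unitI := (`[0, 1]%classic : set R).

Definition pullback (F : M -> M) a : form1 M :=
  fun x => tangent_map F x *m a (F x).

Lemma pullback_comp (F G : M -> M) a : smooth_map F -> smooth_map G ->
  pullback (F \o G) a = pullback G (pullback F a).
Proof.
move=> sF sG; apply/funext => x.
by rewrite /pullback tangent_map_comp // mulmxA.
Qed.

Lemma pullback_id a : pullback id a = a.
Proof. by apply/funext => x; rewrite /pullback tangent_map_id mul1mx. Qed.

Lemma self_bij_mulE phi psi : (phi * psi)%g = phi \o psi :> (M -> M).
Proof. by []. Qed.

Lemma self_bij_invE phi x : (phi^-1)%g (phi x) = x.
Proof. exact: fwdK. Qed.

Lemma self_bij_Einv phi x : phi ((phi^-1)%g x) = x.
Proof. exact: bwdK. Qed.

Lemma tangent_map_inv phi x : smooth_map phi -> smooth_map (phi^-1)%g ->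
  tangent_map (phi^-1)%g (phi x) *m tangent_map phi x = 1%:M.
Proof.
move=> s1 s2.
have := tangent_map_comp (phi x) s1 s2.
rewrite self_bij_invE => <-; rewrite -(tangent_map_id (phi x)).
by congr tangent_map; apply/funext => y; exact: self_bij_Einv.
Qed.

Lemma symplectomorphism_mul phi psi :
  symplectomorphism w phi -> symplectomorphism w psi ->
  symplectomorphism w (phi * psi)%g.
Proof.
move=> [s1 s1' w1] [s2 s2' w2]; split.
- exact: (@smooth_map_comp _ _ _ phi psi).
- by rewrite invgM; exact: (smooth_map_comp s2' s1').
- move=> x; rewrite (@tangent_map_comp _ _ _ phi psi) // trmx_mul.
  by rewrite -[RHS]w2 -[X in _ = _ *m X *m _]w1 !mulmxA.
Qed.

Lemma symplectomorphism_inv phi :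
  symplectomorphism w phi -> symplectomorphism w (phi^-1)%g.
Proof.
move=> [s1 s2 w1]; split; [exact: s2|by rewrite invgK|move=> y].
rewrite -[in RHS](self_bij_Einv phi y).
have I1 := tangent_map_inv ((phi^-1)%g y) s1 s2.
rewrite self_bij_Einv in I1.
rewrite -w1 self_bij_Einv; set T := tangent_map phi _ in I1 *.
set S := tangent_map _ y in I1 *.
by rewrite !mulmxA I1 mul1mx -!mulmxA -trmx_mul I1 trmx1 mulmx1.
Qed.

Lemma symp_path_mul Psi Phi : symp_path w Psi -> symp_path w Phi ->
  symp_path w (fun t => Psi t * Phi t)%g.
Proof.
move=> [h1 s1 i1 z1] [h2 s2 i2 z2]; split.
- by move=> t t01; apply: symplectomorphism_mul; [exact: h1|exact: h2].
- exact: (family_comp s1 s2).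
- have -> : (fun t => (Psi t * Phi t)^-1%g : M -> M) =
      (fun t x => (Phi t)^-1%g ((Psi t)^-1%g x)).
    by apply/funext => t; rewrite invgM.
  exact: (family_comp i2 i1).
- by rewrite z1 z2 mulg1.
Qed.

Lemma symp_path_inv Psi : symp_path w Psi -> symp_path w (fun t => (Psi t)^-1)%g.
Proof.
move=> [h1 s1 i1 z1]; split.
- by move=> t t01; apply: symplectomorphism_inv; exact: h1.
- exact: i1.
- have -> : (fun t => ((Psi t)^-1)^-1%g : M -> M) = (fun t => Psi t : M -> M).
    by apply/funext => t; rewrite invgK.
  exact: s1.
- by rewrite z1 invg1.
Qed.

Lemma velocity_mul Psi Phi (t : R) x : unitI t ->
  symp_path w Psi -> symp_path w Phi ->
  velocity (fun s => Psi s * Phi s)%g t x =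
  velocity Psi t (Phi t x) + velocity Phi t x *m tangent_map (Psi t) (Phi t x).
Proof.
move=> t01 [h1 s1 i1 z1] [h2 s2 i2 z2].
have [sP _ _] := h1 t t01.
apply: (velocityE t01).
have v1 := is_vel_velocity (x := Phi t x) t01 s1.
have v2 := is_vel_velocity (x := x) t01 s2.
exact: (vel_comp s1 s2 sP t01 (mem_dom (Phi t x)) (mem_dom (Psi t (Phi t x))) v2 v1).
Qed.

Lemma cancel_transport (v : 'rV[R]_m) (T S W : 'M[R]_m) : S *m T = 1%:M ->
  (v *m T *m W)^T = S *m (v *m (T *m W *m T^T))^T.
Proof.
move=> ST; rewrite -[S in RHS]trmxK -trmx_mul; congr trmx.
by rewrite -!mulmxA -trmx_mul ST trmx1 mulmx1.
Qed.

(** The velocities of the two paths add after transporting the second by the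
    first; invariance of the symplectic form under [Psi t] turns this transport
    of vectors into the pull-back of the form by the inverse of [Psi t]. *)
Lemma path_form_mul Psi Phi (t : R) : unitI t ->
  symp_path w Psi -> symp_path w Phi ->
  path_form w (fun s => Psi s * Phi s)%g t =
  (fun y => path_form w Psi t y + pullback (Psi t)^-1%g (path_form w Phi t) y).
Proof.
move=> t01 P1 P2; apply/funext => y.
rewrite /path_form /pullback /generator velocity_mul //.
rewrite invgM !self_bij_mulE /= self_bij_Einv.
set v1 := velocity Psi t _; set x := (Psi t)^-1%g y; set v2 := velocity Phi t _.
have [s1 s1' w1] := (let: And4 h _ _ _ := P1 in h) t t01.
have E : Psi t x = y by exact: self_bij_Einv.
have I1 := tangent_map_inv x s1 s1'; rewrite E in I1.
rewrite mulmxDl linearD /=; congr (_ + _).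
rewrite -(w1 x) E.
exact: cancel_transport.
Qed.

Lemma path_form_one t : unitI t -> path_form w (fun _ => 1%g) t = fun _ => 0.
Proof.
move=> t01; apply/funext => y; rewrite /path_form /generator.
have V0 z : velocity (fun _ => 1%g : self_bij M) t z = 0.
  by apply: (velocityE t01); exact: vel_id.
by rewrite V0 mul0mx trmx0.
Qed.

End SympPaths.

(** * Closedness of the forms of a path *)

Lemma tr11 (R : Type) (A : 'M[R]_1) : A^T = A.
Proof. by apply/matrixP => i j; rewrite mxE !ord1. Qed.

Section PullbackClosed.
Context {R : realType} {k l : nat}.
Variables (W : set 'rV[R]_l) (Om : 'rV[R]_l -> 'M[R]_l).
Hypotheses (oW : open W) (sOm : smooth_open W Om).
Hypothesis anti : forall x, W x -> (Om x)^T = - Om x.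
Hypothesis closed_Om : forall x, W x -> forall i j n : 'I_l,
  ('D_(delta_mx 0 i) Om x) j n + ('D_(delta_mx 0 j) Om x) n i
  + ('D_(delta_mx 0 n) Om x) i j = 0.
Variables (U : set 'rV[R]_k) (K : 'rV[R]_k -> 'rV[R]_l).
Hypotheses (oU : open U) (sK : smooth_open U K).
Hypothesis UW : forall z, U z -> W (K z).

Definition pullback2 (u v z : 'rV[R]_k) : 'M[R]_1 :=
  'D_u K z *m Om (K z) *m ('D_v K z)^T.

Lemma sum3_bilinear (T : 'I_l -> 'I_l -> 'I_l -> R) (a b c : 'rV[R]_l) :
  (b *m (\sum_i a 0 i *: \matrix_(j, n) T i j n) *m c^T) 0 0 =
  \sum_i \sum_j \sum_n a 0 i * b 0 j * c 0 n * T i j n.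
Proof.
rewrite mulmx_sumr mulmx_suml summxE; apply: eq_bigr => i _.
rewrite -scalemxAr -scalemxAl mxE mxE mulr_sumr exchange_big /=.
apply: eq_bigr => n _; rewrite !mxE mulr_suml mulr_sumr; apply: eq_bigr => j _.
by rewrite !mxE; ring.
Qed.

(** The coordinate identity of a closed 2-form, extended from basis vectors by
    trilinearity. *)
Lemma closed_trilinear x (a b c : 'rV[R]_l) : W x ->
  b *m 'D_a Om x *m c^T + c *m 'D_b Om x *m a^T + a *m 'D_c Om x *m b^T = 0.
Proof.
move=> Wx; have dOm := smooth_open_differentiable sOm Wx.
pose T (i j n : 'I_l) := ('D_(delta_mx 0 i) Om x) j n.
have DT v : 'D_v Om x = \sum_i v 0 i *: \matrix_(j, n) T i j n.
  rewrite (derive_row_sum v dOm); apply: eq_bigr => i _; congr (_ *: _).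
  by apply/matrixP => j n; rewrite !mxE.
apply/matrixP => i0 j0; rewrite !ord1 [LHS]mxE [X in X + _]mxE.
rewrite (DT a) (DT b) (DT c) !sum3_bilinear [RHS]mxE.
have E1 : \sum_i \sum_j \sum_n b 0 i * c 0 j * a 0 n * T i j n =
  \sum_i \sum_j \sum_n a 0 i * b 0 j * c 0 n * T j n i.
  rewrite exchange_big /=; under eq_bigr do rewrite exchange_big /=.
  rewrite exchange_big /=; apply: eq_bigr => i _.
  rewrite exchange_big /=; apply: eq_bigr => j _; apply: eq_bigr => n _.
  by ring.
have E2 : \sum_i \sum_j \sum_n c 0 i * a 0 j * b 0 n * T i j n =
  \sum_i \sum_j \sum_n a 0 i * b 0 j * c 0 n * T n i j.
  rewrite exchange_big /=; apply: eq_bigr => i _.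
  rewrite exchange_big /=; apply: eq_bigr => j _; apply: eq_bigr => n _.
  by ring.
rewrite E1 E2 -!big_split /=; apply: big1 => i _.
rewrite -!big_split /=; apply: big1 => j _.
rewrite -!big_split /=; apply: big1 => n _.
by rewrite -!mulrDr (closed_Om Wx) mulr0.
Qed.

Lemma pullback2_derive u v w z : U z ->
  differentiable (pullback2 v w) z /\
  'D_u (pullback2 v w) z =
     'D_u ('D_v K) z *m Om (K z) *m ('D_w K z)^T
   + 'D_v K z *m 'D_('D_u K z) Om (K z) *m ('D_w K z)^T
   - 'D_u ('D_w K) z *m Om (K z) *m ('D_v K z)^T.
Proof.
move=> Uz.
have dK := smooth_open_differentiable sK Uz.
have dv := smooth_open_differentiable (smooth_open_derive v sK) Uz.
have dw := smooth_open_differentiable (smooth_open_derive w sK) Uz.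
have dOm := smooth_open_differentiable sOm (UW Uz).
have dOK := differentiable_comp dK dOm.
have [d1 D1] := derive_mulmx dv dOK.
have [d2 D2] := derive_trmx dw.
have [d3 D3] := derive_mulmx d1 d2.
split; first exact: d3.
rewrite [LHS](D3 u) D1 D2 mulmxDl.
have -> : 'D_u (Om \o K) z = 'D_('D_u K z) Om (K z).
  by rewrite [LHS](deriveE u dOK) (diff_comp dK dOm) [RHS](deriveE _ dOm) /= (deriveE u dK).
congr (_ + _).
set b := 'D_v K z; set P := 'D_u _ z.
have {1}-> : b *m (Om \o K) z *m P^T = (b *m (Om \o K) z *m P^T)^T.
  by rewrite [RHS]tr11.
by rewrite !trmx_mul trmxK /= (anti (UW Uz)) mulmxA mulmxN mulNmx.
Qed.

Lemma cyclic_cancel (V : zmodType) (X1 X2 X3 P1 P2 P3 Q1 Q2 Q3 A1 A2 A3 : V) :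
  X1 = P1 + A1 - Q3 -> X2 = P2 + A2 - Q1 -> X3 = P3 + A3 - Q2 ->
  P1 = Q1 -> P2 = Q2 -> P3 = Q3 -> A1 + A2 + A3 = 0 -> X1 + X2 + X3 = 0.
Proof.
move=> -> -> -> -> -> ->.
have E (A P Q : V) : P + A - Q = A + (P - Q) by rewrite addrAC addrC.
rewrite (E A1) (E A2) (E A3) (addrACA A1) (addrACA (A1 + A2)) => ->.
by rewrite add0r [X in X + _]addrC (addrA (Q2 - Q1)) addrNK addrA addrNK subrr.
Qed.

(** The second derivatives of the map cancel in pairs, by their symmetry and
    the antisymmetry of the form; the closedness identity of the form at the
    image point is left. *)
Lemma pullback2_closed u v w z : U z ->
  'D_u (pullback2 v w) z + 'D_v (pullback2 w u) z + 'D_w (pullback2 u v) z = 0.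
Proof.
move=> Uz.
have [_ E1] := pullback2_derive u v w Uz.
have [_ E2] := pullback2_derive v w u Uz.
have [_ E3] := pullback2_derive w u v Uz.
have S1 := derive_sym_mx u v oU Uz sK.
have S2 := derive_sym_mx v w oU Uz sK.
have S3 := derive_sym_mx w u oU Uz sK.
have C := closed_trilinear ('D_u K z) ('D_v K z) ('D_w K z) (UW Uz).
apply: (cyclic_cancel E1 E2 E3 _ _ _ C).
- exact: (congr1 (fun P => P *m Om (K z) *m ('D_w K z)^T) S1).
- exact: (congr1 (fun P => P *m Om (K z) *m ('D_u K z)^T) S2).
- exact: (congr1 (fun P => P *m Om (K z) *m ('D_v K z)^T) S3).
Qed.

Lemma pullback2_anti u v z : U z -> pullback2 v u z = - pullback2 u v z.
Proof.
move=> Uz; rewrite /pullback2.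
by rewrite -[LHS]tr11 !trmx_mul trmxK (anti (UW Uz)) mulmxA mulmxN mulNmx.
Qed.

Lemma smooth_on_pullback2 u v : smooth_on U (pullback2 u v).
Proof.
have sK' : smooth_on U K by exact/(smooth_on_open _ oU).
apply: smooth_on_mulmx; last by apply: smooth_on_trmx; exact: smooth_on_derive.
apply: smooth_on_mulmx; first exact: smooth_on_derive.
apply: (smooth_on_comp sK') UW; exact/(smooth_on_open _ oW).
Qed.

End PullbackClosed.

Section LocallyExact.
Context {R : realType} {m : nat} {M : closed_manifold R m}.
Implicit Types (p q r x : M) (f : M -> R) (a : form1 M).

Definition local_primitive a (U : set M) f : Prop :=
  [/\ open U, smooth_fun_on U f & forall x, U x -> dfun f x = a x].

Definition locally_exact a : Prop :=
  forall x, exists U f, local_primitive a U f /\ U x.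

Lemma to_preferred_chart p x : dom p x ->
  to_preferred p (chart p x) = 'J (rep p x id) (chart p x).
Proof. by move=> px; rewrite /to_preferred (chartK px). Qed.

(** Both sides are the derivative of [F] from the chart [p] to the preferred
    chart of the image point, factored through the preferred chart of [x] and
    through [q]. *)
Lemma preferred_tangent (F : M -> M) p q y : smooth_map F -> img p y ->
  dom q (F (chart_inv p y)) ->
  to_preferred p y *m tangent_map F (chart_inv p y) =
  'J (rep p q F) y *m to_preferred q (rep p q F y).
Proof.
move=> sF py qx; have px := dom_chart_inv py.
set x := chart_inv p y in px qx *.
have yE : y = chart p x by rewrite chart_invK.
have sid := @smooth_map_id _ _ M.
have E1 := @rep_comp _ _ M p (F x) x F id x sF sid px (mem_dom x) (mem_dom (F x)).
have E2 := @rep_comp _ _ M p (F x) q id F x sid sF px qx (mem_dom (F x)).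
have L1 : to_preferred p y = 'J (rep p x id) (chart p x).
  by rewrite to_preferredE -/x -yE.
have L2 : to_preferred q (rep p q F y) = 'J (rep q (F x) id) (chart q (F x)).
  exact: to_preferred_chart.
have L3 : 'J (rep p q F) y = 'J (rep p q F) (chart p x).
  exact: congr1 yE.
have S1 : to_preferred p y *m tangent_map F x = 'J (rep p (F x) F) (chart p x).
  by rewrite L1; exact: esym E1.
have S2 := congr2 (@mulmx R m m m) L3 L2.
exact: etrans S1 (etrans E2 (esym S2)).
Qed.

Lemma local_primitive_chart a p x (B : set 'rV[R]_m) (F : 'rV[R]_m -> R) :
  open B -> B `<=` img p -> smooth_open B F -> dom p x -> B (chart p x) ->
  (forall y v, B y -> 'D_v F y = (v *m local1 a p y) 0 0) ->
  exists U f, local_primitive a U f /\ U x.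
Proof.
move=> oB Bp sF px Bx DF.
pose U := dom p `&` chart p @^-1` B.
exists U, (F \o chart p); split; last by [].
have sid := @smooth_map_id _ _ M.
split.
- rewrite openE => z [pz Bz]; apply: filterI.
    exact: open_near (@dom_open _ _ M p) pz.
  exact: (chart_cvg pz) (open_near oB Bz).
- move=> r.
  have sF' : smooth_on B F by exact/(smooth_on_open _ oB).
  apply: (@smooth_on_comp _ _ _ _ _ B (rep r p id) F) sF' _ => [|y [ry [py By]]//].
  by apply: sub_smooth_on (sid.2 r p) => y [ry [py _]].
- move=> z [pz Bz]; have dF := smooth_open_differentiable sF Bz.
  rewrite (dfun_comp_chart (G := id) sid pz dF).
  have -> : gradient F (chart p z) = local1 a p (chart p z).
    apply/colP => i; rewrite mxE DF // -rowE.
    by rewrite mxE.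
  rewrite /local1 (chartK pz) (to_preferred_chart pz) mulmxA.
  have I1 := etrans (esym (rep_comp sid sid (mem_dom z) pz (mem_dom z)))
    (tangent_map_id z).
  by rewrite [X in X *m _]I1 mul1mx.
Qed.

End LocallyExact.

Section FluxForm.
Context {R : realType} {m : nat} {M : closed_manifold R m}.
Variable w : form2 M.
Hypothesis sw : symplectic_form w.
Implicit Types (p q r x : M) (Psi Phi : R -> self_bij M).
Local Notation unitI := (`[0, 1]%classic : set R).

Lemma local2_anti p y : (local2 w p y)^T = - local2 w p y.
Proof.
have [_ anti _ _] := sw.
by rewrite /local2 !trmx_mul trmxK anti mulNmx mulmxN mulmxA.
Qed.

Lemma congruence_transport (P T J Q W W' : 'M[R]_m) : P *m T = J *m Q ->
  T *m W' *m T^T = W -> J *m (Q *m W' *m Q^T) *m J^T = P *m W *m P^T.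
Proof.
move=> E <-.
have -> : J *m (Q *m W' *m Q^T) *m J^T = (J *m Q) *m W' *m (J *m Q)^T.
  by rewrite trmx_mul !mulmxA.
by rewrite -E trmx_mul !mulmxA.
Qed.

Lemma flux_transport (P T J Q W : 'M[R]_m) (v d : 'rV[R]_m) :
  P *m T = J *m Q -> v = d *m Q ->
  P *m (T *m (v *m W)^T) = J *m (d *m (Q *m W *m Q^T))^T.
Proof. by move=> E ->; rewrite mulmxA E !trmx_mul trmxK !mulmxA. Qed.

(** Invariance is assumed in preferred charts, which jump from point to point;
    differentiating it needs fixed charts on both sides. *)
Lemma local2_invariant (phi : self_bij M) p q y : symplectomorphism w phi ->
  img p y -> dom q (phi (chart_inv p y)) ->
  'J (rep p q phi) y *m local2 w q (rep p q phi y) *m ('J (rep p q phi) y)^T =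
  local2 w p y.
Proof.
move=> [s1 _ inv] py qx; have E := preferred_tangent s1 py qx.
have wq : w (chart_inv q (rep p q phi y)) = w (phi (chart_inv p y)).
  exact: congr1 (chartK qx).
apply: (congruence_transport E); rewrite wq; exact: inv.
Qed.

(** In charts, the pull-back of the form of the path at time [t] is the
    contraction of the pulled-back symplectic form on time and space with the
    time direction. *)
Lemma flux_form_local Phi (t : R) p q y d : symp_path w Phi -> unitI t ->
  img p y -> dom q (Phi t (chart_inv p y)) ->
  is_vel q (fun s => Phi s) t (chart_inv p y) d ->
  local1 (pullback (Phi t) (path_form w Phi t)) p y =
  'J (rep p q (Phi t)) y *m (d *m local2 w q (rep p q (Phi t) y))^T.
Proof.
move=> [h sP iP _] t01 py qx Fd; have [s1 _ _] := h t t01.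
have E := preferred_tangent s1 py qx.
set x := chart_inv p y in qx Fd E.
have pf : path_form w Phi t (Phi t x) = (velocity Phi t x *m w (Phi t x))^T.
  by rewrite /path_form /generator self_bij_invE.
have V := velocityE t01 (vel_chart sP t01 qx (mem_dom (Phi t x)) Fd).
have L2 : to_preferred q (rep p q (Phi t) y) =
    'J (rep q (Phi t x) id) (chart q (Phi t x)).
  exact: to_preferred_chart.
have wq : w (chart_inv q (rep p q (Phi t) y)) = w (Phi t x).
  exact: congr1 (chartK qx).
have V' : velocity Phi t x = d *m to_preferred q (rep p q (Phi t) y).
  by rewrite L2; exact: V.
have L := flux_transport (w (Phi t x)) E V'.
rewrite /local1 /pullback -/x pf /local2 wq; exact: L.
Qed.

Lemma congruence_entry k n (A A' : 'M[R]_k) (B : 'M[R]_(n, k)) (L : 'M[R]_n)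
    (a b : 'rV[R]_k) i j :
  B *m A *m B^T = L -> row i B = a -> row j B = b -> A = A' ->
  (a *m A' *m b^T) 0 0 = L i j.
Proof.
move=> <- <- <- <-; rewrite -row_mul [LHS]mxE [RHS]mxE; apply: eq_bigr => l _.
by congr (_ * _); rewrite !mxE.
Qed.

Lemma mul_tr_entry k n (A A' : 'M[R]_k) (B : 'M[R]_(n, k)) (d a : 'rV[R]_k) i :
  row i B = a -> A = A' ->
  (B *m (d *m A)^T) i 0 = (d *m A' *m a^T) 0 0.
Proof.
move=> <- <-; rewrite [LHS]mxE [RHS]mxE; apply: eq_bigr => l _.
by rewrite mulrC; congr (_ * _); rewrite !mxE.
Qed.

Lemma sum_delta_entry k (b : 'I_k -> 'M[R]_1) j :
  (\sum_i (delta_mx i 0 : 'cV[R]_k) *m b i) j 0 = b j 0 0.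
Proof.
rewrite summxE (bigD1 j) //= mxE big_ord1 mxE !eqxx mul1r big1 ?addr0 //.
by move=> i ij; rewrite mxE big_ord1 mxE eq_sym (negbTE ij) mul0r.
Qed.

(** Extend the path near a point, in charts, to a smooth map of time and space,
    and pull the symplectic form back by it.  The result is a closed 2-form [B];
    at times in [0,1] its space-space entries do not depend on time, because
    the path consists of symplectomorphisms.  The cyclic identity for one time
    and two space directions therefore says that the time-space entries of [B]
    form a closed 1-form in space, and these are the flux form.  The Poincare
    lemma gives a primitive. *)
Lemma flux_form_locally_exact Phi (t : R) : symp_path w Phi -> unitI t ->
  locally_exact (pullback (Phi t) (path_form w Phi t)).
Proof.
move=> P t01 x0; have [h sP iP _] := P.
set c := pullback _ _.
have p0 := mem_dom x0; set p := x0 in p0.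
pose q := Phi t x0; have q0 : dom q (Phi t x0) := mem_dom q.
have [ O [K [oO Oz sK FK]]] := family_ext sP t01 p0 q0.
have [sOm _ _ cl] := sw.
have oq := @img_open _ _ M q.
have sOm' : smooth_open (img q) (local2 w q) by exact/(smooth_on_open _ oq)/sOm.
have anti y : img q y -> (local2 w q y)^T = - local2 w q y.
  by move=> _; exact: local2_anti.
(* Outside [0,1] the extension may leave the chart image where [omega] lives. *)
pose U := O `&` K @^-1` img q.
have oU : open U.
  rewrite openE => z [Oz' qz]; have dK := smooth_open_differentiable sK Oz'.
  exact: filterI (open_near oO Oz') (differentiable_continuous dK (open_near oq qz)).
have sKU : smooth_open U K by apply: sub_smooth_open sK => z [].
have UW z : U z -> img q (K z) by case.
have OU s y : unitI s -> O (time_point s y) -> U (time_point s y).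
  move=> s01 Oy; split=> //=; have [_ qy <-] := FK _ _ s01 Oy.
  exact: img_chart.
pose e : 'rV[R]_(1 + m) := time_point 1 0.
pose v (i : 'I_m) : 'rV[R]_(1 + m) := time_point 0 (delta_mx 0 i).
pose B := pullback2 (local2 w q) K.
have sB a b := smooth_on_pullback2 oq sOm' oU sKU UW a b.
have dB a b z : U z -> differentiable (B a b) z.
  exact: smooth_on_differentiable oU (sB a b).
have repK s y : unitI s -> O (time_point s y) -> rep p q (Phi s) y = K (time_point s y).
  by move=> s01 Oy; have [_ _] := FK _ _ s01 Oy.
have rowJ s y i : unitI s -> O (time_point s y) ->
    row i ('J (rep p q (Phi s)) y) = 'D_(v i) K (time_point s y).
  move=> s01 Oy; have [dKs Ds] := derive_slice (smooth_open_differentiable sK Oy).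
  have nE : \forall y' \near y, (K \o time_point s) y' = rep p q (Phi s) y'.
    have nO : \forall y' \near y, O (time_point s y').
      exact: slice_cvg (open_near oO Oy).
    by apply: filterS nO => y' Oy'; rewrite repK.
  rewrite -(near_jacobian nE dKs) [LHS](row_jacobian i dKs); exact: Ds.
have Bspace s y i j : unitI s -> O (time_point s y) ->
    B (v i) (v j) (time_point s y) = ((local2 w p y) i j)%:M.
  move=> s01 Oy; have [py qy _] := FK _ _ s01 Oy.
  rewrite [LHS]mx11_scalar; congr (_%:M).
  have inv := local2_invariant (h s s01) py qy.
  apply: (congruence_entry inv (rowJ s y i s01 Oy) (rowJ s y j s01 Oy)).
  exact: congr1 (repK s y s01 Oy).
have flux y : O (time_point t y) -> forall i,
    local1 c p y i 0 = B e (v i) (time_point t y) 0 0.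
  move=> Oy i; have [py qy _] := FK _ _ t01 Oy.
  have px := dom_chart_inv py.
  have Oy' : O (time_point t (chart p (chart_inv p y))) by rewrite chart_invK.
  have V := vel_ext sP t01 oO Oy' sK px FK.
  rewrite (flux_form_local P t01 py qy V) chart_invK //.
  have KE : local2 w q (rep p q (Phi t) y) = local2 w q (K (time_point t y)).
    exact: congr1 (repK t y t01 Oy).
  exact: (mul_tr_entry _ (rowJ t y i t01 Oy) KE).
(* The derivative of the extension in time is a limit within [0,1], where the
   entry is constant; this covers the end points as well. *)
have DeB y i j : O (time_point t y) -> 'D_e (B (v i) (v j)) (time_point t y) = 0.
  move=> Oy; have Uy := OU _ _ t01 Oy.
  pose hB (s : R) := B (v i) (v j) (time_point s y).
  have dh : is_derive t 1 hB ('D_e (B (v i) (v j)) (time_point t y)).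
    have -> : hB = (fun s : R => B (v i) (v j) (time_point 0 y + s *: time_point 1 0)).
      by apply/funext => s; rewrite -time_point_line.
    rewrite [time_point t _]time_point_line; apply: derive_line.
    apply: diff_derivable; rewrite -time_point_line; exact: dB.
  have nO : \forall s \near within_unit_dnbhs t, unitI s /\ O (time_point s y).
    apply: near_within_unit; apply: filterS (near_time_point oO Oy) => s Os s01.
    by [].
  have w0 : is_wderive (fun _ : R => ((local2 w p y) i j)%:M : 'M[R]_1) t 0.
    rewrite /is_wderive; under eq_fun => s do rewrite subrr scaler0.
    exact: cvg_cst.
  apply: (is_wderive_unique t01 _ w0).
  apply: near_is_wderive (is_derive_wderive dh).
    by rewrite /hB Bspace.
  by apply: filterS nO => s [s01 Os]; rewrite /hB Bspace.
pose g (y : 'rV[R]_m) : 'cV[R]_m :=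
  \sum_i (delta_mx i 0 : 'cV[R]_m) *m B e (v i) (time_point t y).
have gE y j : g y j 0 = B e (v j) (time_point t y) 0 0.
  exact: sum_delta_entry.
have ONt y : O (time_point t y) -> local1 c p y = g y.
  by move=> Oy; apply/colP => i; rewrite flux // gE.
have [r r0 Hr] : exists2 r : R, 0 < r & forall y, ball (chart p x0) r y ->
    U (time_point t y).
  have nU := slice_cvg (open_near oU (OU _ _ t01 Oz)).
  have /nbhs_ballP[r /= r0 Hr] : nbhs (chart p x0) (fun y => U (time_point t y)).
    exact: nU.
  by exists r.
have oB := ball_open (chart p x0) r.
have sg : smooth_open (ball (chart p x0) r) g.
  apply/(smooth_on_open _ oB); apply: smooth_on_sum => i.
  apply: smooth_on_mulmx; first exact: smooth_on_cst.
  exact: (smooth_on_comp (@smooth_on_slice _ _ _ t) (sB e (v i)) Hr).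
have Dg y i j : ball (chart p x0) r y ->
    ('D_(delta_mx 0 i) g y) j 0 = ('D_(v i) (B e (v j)) (time_point t y)) 0 0.
  move=> By; have dg := smooth_open_differentiable sg By.
  have [_ D1] := derive_entry j 0 dg.
  have [dBs D2] := derive_slice (dB e (v j) _ (Hr y By)).
  have [_ D3] := derive_entry 0 0 dBs.
  have E : (fun y => g y j 0) = (fun y => (B e (v j) \o time_point t) y 0 0).
    by apply/funext => z; exact: gE.
  rewrite -[LHS]D1 E [LHS]D3; exact: (congr1 (fun A : 'M[R]_1 => A 0 0) (D2 _)).
have cg y : ball (chart p x0) r y -> forall i j,
    ('D_(delta_mx 0 i) g y) j 0 = ('D_(delta_mx 0 j) g y) i 0.
  move=> By i j; have Uy := Hr y By.
  have C := pullback2_closed sOm' anti (cl q) oU sKU UW (v i) e (v j) Uy.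
  have A : 'D_(v j) (B (v i) e) (time_point t y) =
      - 'D_(v j) (B e (v i)) (time_point t y).
    have d := @diff_derivable _ _ _ _ _ (v j) (dB e (v i) _ Uy).
    rewrite -[RHS](deriveN d); apply: (eq_derive_open _ oU Uy) => z Uz.
    exact: (pullback2_anti anti UW).
  have S : 'D_(v i) (B e (v j)) (time_point t y) =
      'D_(v j) (B e (v i)) (time_point t y).
    apply/eqP; rewrite -subr_eq0; apply/eqP.
    by have := C; rewrite [X in _ + X + _](DeB y j i Uy.1) addr0 [X in _ + X]A.
  rewrite [LHS](Dg y i j By) [RHS](Dg y j i By).
  exact: (congr1 (fun A : 'M[R]_1 => A 0 0) S).
have [F [sF DF]] := poincare sg cg.
apply: (@local_primitive_chart _ _ M c p x0 (ball (chart p x0) r) F oB _ sF p0).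
- by move=> y By; have [py _ _] := FK _ _ t01 (Hr y By).1.
- exact: ballxx.
- by move=> y u By; rewrite (DF y u By) ONt //; have [] := Hr y By.
Qed.

End FluxForm.

(** * Homotopy invariance *)

Lemma locally_const_interval (R : realType) (T : Type) (I : set R) (r : R -> T) :
  is_interval I ->
  (forall s, I s -> \forall s' \near s, I s' -> r s' = r s) ->
  forall s0 s, I s0 -> I s -> r s = r s0.
Proof.
move=> /connected_intervalP cI loc s0 s Is0 Is.
pose A := [set s' | I s' /\ r s' = r s0].
suff AI : A = I.
  have : A s by rewrite AI.
  by case.
apply: cI.
- by exists s0.
- exists (interior [set s' | I s' -> r s' = r s0]); first exact: open_interior.
  apply/seteqP; split=> [s' [Is' E]|s' [Is' /interior_subset /(_ Is') E]] //.
  split=> //; rewrite /interior /= -E; exact: loc.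
- exists (~` interior [set s' | I s' -> r s' <> r s0]).
    by apply: open_closedC; exact: open_interior.
  apply/seteqP; split=> [s' [Is' E]|s' [Is' nE]].
    by split=> // /interior_subset /(_ Is').
  split=> //; apply: contrapT => E; apply: nE; rewrite /interior /=.
  by apply: filterS (loc s' Is') => u Eu Iu; rewrite Eu.
Qed.

Section Homotopy.
Context {R : realType} {m : nat} {M : closed_manifold R m}.
Implicit Types (p q r x : M) (f : M -> R) (a : form1 M) (G : R -> M -> M).
Local Notation unitI := (`[0, 1]%classic : set R).

Lemma gradient_chart (U : set M) f p z : open U -> smooth_fun_on U f -> U z ->
  dom p z -> gradient (f \o chart_inv p) (chart p z) =
    'J (rep p z id) (chart p z) *m dfun f z.
Proof.
move=> oU sf Uz pz.
have sid := @smooth_map_id _ _ M.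
have dr : differentiable (rep p z id) (chart p z).
  by apply: (rep_differentiable sid pz); exact: mem_dom.
have rz : rep p z id (chart p z) = chart z z by rewrite /rep /= chartK.
have df := smooth_fun_on_differentiable oU sf Uz (mem_dom z).
have df' : differentiable (f \o chart_inv z) (rep p z id (chart p z)) by rewrite rz.
have G := gradient_comp dr df'; rewrite rz in G.
apply: etrans G; apply: gradient_near.
have nz := open_near (@dom_open _ _ M z) (mem_dom z).
apply: filterS (near_chart_inv pz nz) => y [py zy].
by rewrite /rep /= chartK.
Qed.

(** The difference of two primitives has zero differential in one chart on a
    whole ball, and is constant there. *)
Lemma primitives_differ_by_constant a U1 f1 U2 f2 x :
  local_primitive a U1 f1 -> local_primitive a U2 f2 -> U1 x -> U2 x ->
  \forall y \near x, f1 y - f2 y = f1 x - f2 x.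
Proof.
move=> [oU1 s1 D1] [oU2 s2 D2] U1x U2x.
pose U := U1 `&` U2; have oU : open U by exact: openI.
pose f y := f1 y + - f2 y.
have s1' : smooth_fun_on U f1 by apply: sub_smooth_fun_on s1 => z [].
have s2' : smooth_fun_on U f2 by apply: sub_smooth_fun_on s2 => z [].
have sf : smooth_fun_on U f := smooth_fun_onD s1' (smooth_fun_onN s2').
have Df z : U z -> dfun f z = 0.
  move=> Uz; rewrite (dfunD oU Uz s1' (smooth_fun_onN s2')) (dfunN oU Uz s2').
  by rewrite D1 ?D2 ?subrr //; case: Uz.
pose V := [set y | img x y /\ U (chart_inv x y)].
have oV : open V by exact: open_pullback.
have px := mem_dom x.
have Vx : V (chart x x) by split; [exact: img_chart|rewrite chartK].
have dV y : V y -> differentiable (f \o chart_inv x) y.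
  move=> [xy Uy]; rewrite -(chart_invK xy).
  exact: (smooth_fun_on_differentiable oU sf Uy (dom_chart_inv xy)).
have DV y v : V y -> 'D_v (f \o chart_inv x) y = 0.
  move=> Vy; rewrite -(mul_gradient _ (dV y Vy)); have [xy Uy] := Vy.
  have := gradient_chart oU sf Uy (dom_chart_inv xy).
  by rewrite (Df _ Uy) mulmx0 chart_invK // => ->; rewrite mulmx0 mxE.
have [e e0 He] : exists2 e : R, 0 < e & ball (chart x x) e `<=` V.
  have /nbhs_ballP[e /= e0 He] : nbhs (chart x x) V by exact: open_near oV Vx.
  by exists e.
have nb : \forall y \near x, dom x y /\ ball (chart x x) e (chart x y).
  have H2 : nbhs (chart x x) (ball (chart x x) e) by exact: nbhsx_ballx.
  exact: filterI (open_near (@dom_open _ _ M x) px) (chart_cvg px H2).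
apply: filterS nb => y [xy By].
have := @ball_const _ _ (f \o chart_inv x) (chart x x) e
  (fun z Bz => dV z (He z Bz)) (fun z v Bz => DV z v (He z Bz))
  _ _ By (ballxx _ e0).
by rewrite /= !chartK.
Qed.

(** By compactness of [M], for small [e] each short arc [s |-> G s x] with
    [`|s - s0| < e] lies in the domain [U] of a local primitive [f], and
    [f (G s x) - f (G s0 x)] is a primitive of the difference of pull-backs.
    This increment does not depend on the choice of [f]: two primitives differ
    by a locally constant function, hence by a constant along the arc.  So the
    increments define one smooth function on [M]. *)
Lemma homotopy_step G a s0 : smooth_family G ->
  (forall s, unitI s -> smooth_map (G s)) -> locally_exact a -> unitI s0 ->
  \forall s \near s0, unitI s ->
    @B1 R m M (fun x => pullback (G s) a x - pullback (G s0) a x).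
Proof.
move=> sG smG ea s01.
pose near_U (e : R) x (U : set M) := \forall x' \near x, forall s,
  unitI s -> `|s - s0| < e -> U (G s x').
have cM : near_covering [set: M].
  by apply/compact_near_coveringP; exact: (@manifold_compact _ _ M).
have : \forall e \near (0 : R)^'+, [set: M] `<=`
    (fun x => exists U f, local_primitive a U f /\ near_U e x U).
  apply: cM => x _.
  have [U [f [pf Ux]]] := ea (G s0 x).
  have [oU _ _] := pf.
  have [[A B] /= [As0 Bx] AB] := family_cvg sG s01 (open_near oU Ux).
  have /nbhs_ballP[e0 /= e00 He0] := As0.
  exists (interior B, [set e | e < e0]) => /=.
    split; first exact: nbhs_interior.
    exact: nbhs_right_lt.
  move=> [x' e] /= [Bx' ee0]; exists U, f; split=> //.
  apply: filterS Bx' => x'' Bx'' s s01' se.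
  apply: (AB (s, x'')) => //; split=> //; apply: He0.
  by rewrite -ball_normE /= distrC (lt_trans se).
move=> ne.
have [e [e0 /= He]] := filter_ex (filterI (nbhs_right_gt (0 : R)) ne).
have {}He x : exists Uf : set M * (M -> R),
    local_primitive a Uf.1 Uf.2 /\ near_U e x Uf.1.
  by have [U [f Hf]] := He x I; exists (U, f).
have [Uf HUf] := choice He.
have nb : \forall s \near s0, `|s - s0| < e.
  apply/nbhs_ballP; exists e => // s; rewrite -ball_normE /=.
  by rewrite distrC.
apply: filterS nb => s se Is.
pose h x := (Uf x).2 (G s x) + - (Uf x).2 (G s0 x).
pose g x0 x := (Uf x0).2 (G s x) + - (Uf x0).2 (G s0 x).
have s0e : `|s0 - s0| < e by rewrite subrr normr0.
have hg x0 x : (forall s', unitI s' -> `|s' - s0| < e -> (Uf x0).1 (G s' x)) ->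
    h x = g x0 x.
  move=> Hx; have [p1 n1] := HUf x; have [p0 _] := HUf x0.
  have H1 := nbhs_singleton n1.
  pose J := [set s' | unitI s' /\ `|s' - s0| < e].
  have iJ : is_interval J.
    move=> u v [+ u1] [+ v1] z; rewrite /= !in_itv /=.
    move=> /andP[u0 _] /andP[_ v0] /andP[uz zv].
    split; first by rewrite /= in_itv /= (le_trans u0 uz) (le_trans zv v0).
    move: u1 v1; rewrite !ltr_distl => /andP[u1 _] /andP[_ v1].
    by rewrite (lt_le_trans u1 uz) (le_lt_trans zv v1).
  have := @locally_const_interval _ _ J
    (fun s' => (Uf x).2 (G s' x) - (Uf x0).2 (G s' x)) iJ.
  move=> /(_ _ s0 s) E.
  have {}E : (Uf x).2 (G s x) - (Uf x0).2 (G s x) =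
             (Uf x).2 (G s0 x) - (Uf x0).2 (G s0 x).
    apply: E => // s' [Is' s'e].
    have nE := primitives_differ_by_constant p1 p0 (H1 s' Is' s'e) (Hx s' Is' s'e).
    have [[A B] /= [As' Bx] AB] := family_cvg sG Is' nE.
    apply: filterS As' => u Au [Iu _].
    by apply: (AB (u, x)) => //; split=> //; exact: nbhs_singleton.
  rewrite /h /g; apply/eqP; rewrite -subr_eq0; move/eqP: E; rewrite -subr_eq0.
  by congr (_ == _); rewrite !opprD !opprK; ring.
have loc x0 : exists V : set M, [/\ open V, V x0, smooth_fun_on V (g x0),
    V `<=` (fun x => h x = g x0 x) &
    V `<=` (fun x => (Uf x0).1 (G s x) /\ (Uf x0).1 (G s0 x))].
  have [[oU sf _] n0] := HUf x0.
  have : nbhs x0 [set x | forall s, unitI s -> `|s - s0| < e -> (Uf x0).1 (G s x)].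
    exact: n0.
  rewrite nbhsE => -[V [oV Vx] HV]; exists V; split=> //.
  - apply: smooth_fun_onD; last apply: smooth_fun_onN.
      apply: sub_smooth_fun_on (smooth_fun_on_comp (smG s Is) sf) => x Vx'.
      exact: HV Vx' s Is se.
    apply: sub_smooth_fun_on (smooth_fun_on_comp (smG s0 s01) sf) => x Vx'.
    exact: HV Vx' s0 s01 s0e.
  - by move=> x Vx'; apply: hg; exact: HV Vx'.
  - by move=> x Vx'; split; apply: HV.
exists h.
  by apply/smooth_funP/smooth_funP; apply: smooth_fun_local => x0;
    have [V [oV Vx sg hgV _]] := loc x0; exists V, (g x0); split.
apply/funext => x0.
have [V [oV Vx sg hgV VU]] := loc x0.
have [[oU sf Df] _] := HUf x0.
have [Us Us0] := VU _ Vx.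
have hgx : \forall x \near x0, h x = g x0 x.
  by apply: filterS (open_near oV Vx).
rewrite (dfun_near hgx).
have s1 : smooth_fun_on V ((Uf x0).2 \o G s).
  by apply: sub_smooth_fun_on (smooth_fun_on_comp (smG s Is) sf) => x /VU[].
have s2 : smooth_fun_on V ((Uf x0).2 \o G s0).
  by apply: sub_smooth_fun_on (smooth_fun_on_comp (smG s0 s01) sf) => x /VU[].
have D := dfunD oV Vx s1 (smooth_fun_onN s2).
apply: (etrans D); rewrite (dfunN oV Vx s2).
rewrite (dfun_comp (smG s Is) oU sf Us) (dfun_comp (smG s0 s01) oU sf Us0).
by rewrite !Df.
Qed.

(** The cohomology class of the pull-back is locally constant in [s], so it is
    constant on [0,1]. *)
Lemma homotopy G a s : smooth_family G ->
  (forall s, unitI s -> smooth_map (G s)) -> locally_exact a -> unitI s ->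
  @B1 R m M (fun x => pullback (G s) a x - pullback (G 0) a x).
Proof.
move=> sG smG ea s1.
have I0 : unitI 0 by rewrite /= in_itv /= lexx ler01.
pose E s := @B1 R m M (fun x => pullback (G s) a x - pullback (G 0) a x).
have step := fun s0 => @homotopy_step G a s0 sG smG ea.
have E0 : E 0 by exact: (nbhs_singleton (step 0 I0) I0).
suff Es : E s = E 0 by rewrite -Es in E0.
have iI : is_interval unitI.
  move=> u v; rewrite /= !in_itv /= => /andP[u0 _] /andP[_ v0] z /andP[uz zv].
  by rewrite in_itv /= (le_trans u0 uz) (le_trans zv v0).
apply: (locally_const_interval iI _ I0 s1).
move=> s0 Is0; apply: filterS (step s0 Is0) => s' B Is'.
have {}B := B Is'.
apply/propext; split=> H.
- have := B1D H (B1N B); congr B1; apply/funext => x.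
  by rewrite /= opprB addrC addrA addrNK.
- have := B1D B H; congr B1; apply/funext => x.
  by rewrite /= addrA addrNK.
Qed.

End Homotopy.

(** * Flux and conjugation *)

Section Flux.
Context {R : realType} {m : nat} {M : closed_manifold R m}.
Variable w : form2 M.
Hypothesis sw : symplectic_form w.
Implicit Types (Psi Phi Theta : R -> self_bij M) (a b : form1 M).
Implicit Types (phi psi theta : self_bij M).
Local Notation unitI := (`[0, 1]%classic : set R).

Definition cohomologous a b : Prop := @B1 R m M (fun x => a x - b x).

Lemma cohomologous_sym a b : cohomologous a b -> cohomologous b a.
Proof. by move=> /B1N; congr B1; apply/funext => x; rewrite opprB. Qed.

Lemma cohomologous_trans a b c :
  cohomologous a b -> cohomologous b c -> cohomologous a c.
Proof.
by move=> ab /(B1D ab); congr B1; apply/funext => x; rewrite addrA addrNK.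
Qed.

Lemma cohomologousD a b c d : cohomologous a b -> cohomologous c d ->
  cohomologous (fun x => a x + c x) (fun x => b x + d x).
Proof.
move=> ab /(B1D ab); congr B1; apply/funext => x.
by rewrite addrACA opprD.
Qed.

Lemma cohomologous_refl a : cohomologous a a.
Proof.
exists (fun _ => 0).
  by move=> p; exact: smooth_on_cst.
apply/funext => x; rewrite subrr; apply/colP => i; rewrite !mxE.
have -> : (fun _ : M => (0 : R)) \o chart_inv x = cst 0 by [].
by rewrite derive_cst.
Qed.

Lemma cohomologous_exact a b : cohomologous a b -> @B1 R m M b -> @B1 R m M a.
Proof.
by move=> ab /(B1D ab); congr B1; apply/funext => x; rewrite addrNK.
Qed.

Lemma inv_family_smooth Psi t : symp_path w Psi -> unitI t ->
  smooth_map (Psi t)^-1%g.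
Proof. by move=> [h _ _ _] /h []. Qed.

(** At each time the class of the form of a path is additive.  The product rule
    for [path_form] involves the pull-back of the second form by the inverse of
    the first path; both this pull-back and the form itself are pull-backs of
    one locally exact form by inverses of paths, so homotopy invariance
    identifies their classes. *)
Lemma flux_mul Psi Phi (t : R) : symp_path w Psi -> symp_path w Phi -> unitI t ->
  cohomologous (path_form w (fun s => Psi s * Phi s)%g t)
    (fun x => path_form w Psi t x + path_form w Phi t x).
Proof.
move=> P1 P2 t01; rewrite (path_form_mul t01 P1 P2).
apply: cohomologousD; first exact: cohomologous_refl.
set b := path_form w Phi t.
pose c := pullback (Phi t) b.
have ec : locally_exact c := flux_form_locally_exact sw P2 t01.
have [s1 s1'] : smooth_map (Psi t) /\ smooth_map (Psi t)^-1%g.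
  by have [h _ _ _] := P1; have [] := h t t01.
have [s2 s2'] : smooth_map (Phi t) /\ smooth_map (Phi t)^-1%g.
  by have [h _ _ _] := P2; have [] := h t t01.
have bE : b = pullback (Phi t)^-1%g c.
  have I : Phi t \o (Phi t)^-1%g = @id M.
    by apply/funext => x; exact: self_bij_Einv.
  by have := pullback_comp b s2 s2'; rewrite I pullback_id.
have P12 := symp_path_mul P1 P2.
have H (Q : R -> self_bij M) : symp_path w Q ->
    cohomologous (pullback (Q t)^-1%g c) c.
  move=> PQ; have [_ _ sQ z0] := PQ.
  have := homotopy sQ (fun s Is => inv_family_smooth PQ Is) ec t01.
  by rewrite z0 invg1 pullback_id.
have E : pullback (Psi t)^-1%g b = pullback (Psi t * Phi t)^-1%g c.
  have := pullback_comp c s2' s1'; rewrite -bE => <-.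
  by rewrite invgM.
rewrite E [X in cohomologous _ X]bE.
apply: cohomologous_trans (H _ P12) _; apply: cohomologous_sym; exact: H.
Qed.

Lemma flux_inv Psi (t : R) : symp_path w Psi -> unitI t ->
  cohomologous (path_form w (fun s => (Psi s)^-1)%g t)
    (fun x => - path_form w Psi t x).
Proof.
move=> P t01.
have := flux_mul P (symp_path_inv P) t01.
have -> : (fun s => Psi s * (Psi s)^-1)%g = (fun _ => 1%g).
  by apply/funext => s; rewrite mulgV.
rewrite path_form_one // => /cohomologous_sym; congr B1; apply/funext => x.
by rewrite subr0 opprK addrC.
Qed.

(** The classes of the commuting factors cancel at every time, so the path of
    commutators times a Hamiltonian path is Hamiltonian. *)
Lemma commutator_mul_Ham psi theta phi : Symp0 w psi -> Symp0 w theta ->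
  Ham w phi -> Ham w (psi * theta * psi^-1 * theta^-1 * phi)%g.
Proof.
move=> [Psi P1 <-] [ Theta P2 <-] [Phi [P3 H3 <-]].
have P1' := symp_path_inv P1; have P2' := symp_path_inv P2.
have P12 := symp_path_mul P1 P2; have P121 := symp_path_mul P12 P1'.
have P1212 := symp_path_mul P121 P2'; have P := symp_path_mul P1212 P3.
exists (fun s => Psi s * Theta s * (Psi s)^-1 * (Theta s)^-1 * Phi s)%g.
split; [exact: P| |by []] => t t01.
have F1 := flux_mul P1 P2 t01.
have F2 := flux_mul P12 P1' t01.
have F3 := flux_mul P121 P2' t01.
have F4 := flux_mul P1212 P3 t01.
apply: (cohomologous_exact F4); apply: (B1D _ (H3 t t01)).
have G2 := cohomologous_trans F2 (cohomologousD F1 (flux_inv P1 t01)).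
have G3 := cohomologous_trans F3 (cohomologousD G2 (flux_inv P2 t01)).
move: G3; congr B1; apply/funext => x.
by rewrite [X in X - _ - _]addrC addrK subrr subr0.
Qed.

Lemma Symp0_mul phi psi : Symp0 w phi -> Symp0 w psi -> Symp0 w (phi * psi)%g.
Proof.
move=> [Phi P1 <-] [Psi P2 <-].
by exists (fun s => Phi s * Psi s)%g; first exact: symp_path_mul.
Qed.

Lemma Symp0_inv phi : Symp0 w phi -> Symp0 w phi^-1%g.
Proof.
move=> [Phi P1 <-].
by exists (fun s => (Phi s)^-1)%g; first exact: symp_path_inv.
Qed.

Section Invariance.
Variables (nB : form1 M -> R) (g : form2 M).
Variables (vol : {measure set (borel M) -> \bar R}).
Variables (mu : form1 M -> form1 M) (c : R).
Local Notation Delta := (Delta w nB g vol mu c).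

(** A conjugate of [theta] is a commutator times [theta], and translation by
    commutators permutes [Ham]; hence both infima run over the same set. *)
Lemma Delta_conj psi theta : Symp0 w psi -> Symp0 w theta ->
  Delta (conjugation psi theta) = Delta theta.
Proof.
move=> Spsi Stheta; rewrite /Defs.Delta; congr ereal_inf.
apply/seteqP; split=> [_ [phi Hphi <-]|_ [phi Hphi <-]].
  exists (theta * psi * theta^-1 * psi^-1 * phi)%g.
    exact: commutator_mul_Ham.
  rewrite /dist /conjugation; congr dist_id.
  by rewrite !invgM !invgK !mulgA mulgVK.
exists (psi * theta * psi^-1 * theta^-1 * phi)%g.
  exact: commutator_mul_Ham.
rewrite /dist /conjugation; congr dist_id.
by rewrite !invgM !invgK !mulgA !mulgVK mulgK.
Qed.

Lemma sub_conj_Delta_sphere psi r : Symp0 w psi ->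
  conjugation psi @` Delta_sphere w nB g vol mu c r `<=`
  Delta_sphere w nB g vol mu c r.
Proof.
move=> Spsi _ [theta [St Dt] <-]; split; last by rewrite Delta_conj.
by apply: Symp0_mul; [exact: Symp0_mul|exact: Symp0_inv].
Qed.

End Invariance.

End Flux.

Theorem corollary3p2 (R : realType) (m : nat) (M : closed_manifold R m)
  (omega : form2 M) (homega : symplectic_form omega)
  (nB : form1 M -> R) (hnB : norm_on (@B1 R m M) nB)
  (g : form2 M) (hg : riemannian_metric g)
  (vol : {measure set (borel M) -> \bar R}) (hvol : riemannian_volume g vol)
  (mu : form1 M -> form1 M) (hmu : linear_between (@Z1 R m M) (@B1 R m M) mu)
  (c : R) (hc0 : 0 <= c) (hc : c != 0)
  (psi : self_bij M) (hpsi : Symp0 omega psi) (r : R) :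
  conjugation psi @` Delta_sphere omega nB g vol mu c r =
  Delta_sphere omega nB g vol mu c r.
Proof.
apply/seteqP; split; first exact: sub_conj_Delta_sphere.
move=> theta St.
exists (conjugation psi^-1%g theta); last first.
  by rewrite /conjugation invgK !mulgA mulgV mul1g mulgK.
apply: (sub_conj_Delta_sphere homega (Symp0_inv hpsi)).
by exists theta.
Qed.
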